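(* Let $d\ge 1$, $\tau>d$, $\gamma>0$, $L>0$. Assume $\omega\in \mathrm{DC}_{\tau,\gamma}$ and $v$ belongs to the UBLM class with Lipschitz parameter $L$. Then there exists $\varepsilon_0=\varepsilon_0(L,d,\tau,\gamma)>0$ such that for all $0\le\varepsilon\le\varepsilon_0$: (1) for every $\theta\in\mathbb R\setminus(\mathbb Z+\mathbb Z^d\cdot\omega)$, $H(\theta)$ satisfies Anderson localization (pure point spectrum with exponentially decaying eigenfunctions); (2) for every $\theta\in\mathbb R\setminus(\mathbb Z+\mathbb Z^d\cdot\omega)$, there is a constant $C(\varepsilon)$ such that for all $x,y\in\mathbb Z^d$, $$\sup_{t\in\mathbb R}|\langle e^{itH(\theta)}\mathbf e_x,\mathbf e_y\rangle|\le C(\varepsilon)e^{-\frac{1}{800}|\ln\varepsilon|\,\|x-y\|_1}.$$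
   Context: For $x\in\mathbb Z^d$, $\|x\|_1=\sum_i|x_i|$, $x\cdot\omega=\sum_i x_i\omega_i$, $\mathbb Z+\mathbb Z^d\cdot\omega=\{k+x\cdot\omega: k\in\mathbb Z, x\in\mathbb Z^d\}$. $\mathrm{DC}_{\tau,\gamma}=\{\omega\in[0,1]^d:\ \inf_{l\in\mathbb Z}|l-x\cdot\omega|\ge \gamma\|x\|_1^{-\tau}\ \forall x\ne0\}$. $H(\theta)=\varepsilon\Delta+v(\theta+x\cdot\omega)\delta_{x,y}$ on $\ell^2(\mathbb Z^d)$, with $\Delta(x,y)=1$ if $\|x-y\|_1=1$, else $0$. UBLM class: $v$ is a 1-periodic real-valued function on $\mathbb R\setminus\mathbb Z$, continuous on $(0,1)$, with $v(\theta_2)-v(\theta_1)\ge L(\theta_2-\theta_1)$ for all $0<\theta_1\le\theta_2<1$, $\lim_{\theta\to0^+}v(\theta)=-\infty$ and $\lim_{\theta\to1^-}v(\theta)=+\infty$. $\{\mathbf e_x\}$ is the standard basis of $\ell^2(\mathbb Z^d)$. *)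

(* Defs.v *)
From HB Require Import structures.
From mathcomp Require Import all_boot all_order all_algebra.
From mathcomp Require Import all_classical all_reals all_analysis.
Set Implicit Arguments. Unset Strict Implicit. Unset Printing Implicit Defensive.
Import Order.TTheory GRing.Theory Num.Theory.
Import numFieldNormedType.Exports.
Local Open Scope ring_scope.
Local Open Scope classical_set_scope.

Notation Zd d := ('rV[int]_d).

Definition norm1 {d : nat} (x : Zd d) : nat := (\sum_(i < d) `|x ord0 i|%N)%N.

Definition dotw {R : realType} {d : nat} (x : Zd d) (w : 'I_d -> R) : R :=
  \sum_(i < d) (x ord0 i)%:~R * w i.

Definition unitv {d : nat} (i : 'I_d) : Zd d := delta_mx ord0 i.

Definition DC {R : realType} (d : nat) (tau gamma : R) (w : 'I_d -> R) : Prop :=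
  (forall i, 0 <= w i <= 1) /\
  forall (x : Zd d), x != 0 -> forall l : int,
    gamma * powR (norm1 x)%:R (- tau) <= `| l%:~R - dotw x w |.

(* UBLM class with Lipschitz parameter L; values of v on Z are irrelevant *)
Definition UBLM {R : realType} (L : R) (v : R -> R) : Prop :=
  (forall t : R, t \notin (range (fun k : int => k%:~R)) -> v (t + 1) = v t) /\
  {within `]0, 1[, continuous v} /\
  (forall t1 t2 : R, 0 < t1 -> t1 <= t2 -> t2 < 1 -> L * (t2 - t1) <= v t2 - v t1) /\
  (v x @[x --> 0^'+] --> -oo) /\
  (v x @[x --> 1^'-] --> +oo).

Definition in_resonant_orbit {R : realType} {d : nat} (w : 'I_d -> R) (theta : R) : Prop :=
  exists (k : int) (x : Zd d), theta = k%:~R + dotw x w.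

Definition Lap {R : realType} {d : nat} (f : Zd d -> R) (x : Zd d) : R :=
  \sum_(i < d) (f (x + unitv i) + f (x - unitv i)).

Definition Hop {R : realType} {d : nat} (eps : R) (v : R -> R) (w : 'I_d -> R)
  (theta : R) (f : Zd d -> R) (x : Zd d) : R :=
  eps * Lap f x + v (theta + dotw x w) * f x.

Definition box_sum {R : realType} {d : nat} (N : nat) (F : Zd d -> R) : R :=
  \sum_(k : {ffun 'I_d -> 'I_(N.*2.+1)})
     F (\row_i ((k i : nat)%:Z - N%:Z)).

Definition l2 {R : realType} {d : nat} (f : Zd d -> R) : Prop :=
  exists M : R, forall N, box_sum N (fun x => f x ^+ 2) <= M.

(* l^2 inner product (an absolutely convergent sum for f, g in l^2) *)
Definition l2inner {R : realType} {d : nat} (f g : Zd d -> R) : R :=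
  limn (fun N => box_sum N (fun x => f x * g x)).

(* (psi n, E n) is a complete orthonormal family of l^2 eigenfunctions of H:
   i.e. H has pure point spectrum, psi being an eigenbasis. *)
Definition eigenbasis {R : realType} {d : nat} (H : (Zd d -> R) -> Zd d -> R)
  (psi : nat -> Zd d -> R) (E : nat -> R) : Prop :=
  (forall n, l2 (psi n)) /\
  (forall n x, H (psi n) x = E n * psi n x) /\
  (forall n m, l2inner (psi n) (psi m) = if n == m then 1 else 0) /\
  (forall f, l2 f -> (forall n, l2inner f (psi n) = 0) -> f = (fun _ => 0)).

Definition exp_decaying {R : realType} {d : nat} (f : Zd d -> R) : Prop :=
  exists C c : R, 0 < c /\ forall x, `| f x | <= C * expR (- c * (norm1 x)%:R).

Definition anderson_loc {R : realType} {d : nat} (H : (Zd d -> R) -> Zd d -> R) : Prop :=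
  exists (psi : nat -> Zd d -> R) (E : nat -> R),
    eigenbasis H psi E /\ forall n, exp_decaying (psi n).

(* Real and imaginary parts of <e^{itH} e_x, e_y> = sum_n e^{i t E_n} psi_n(x) psi_n(y),
   computed in a (real) complete orthonormal eigenbasis of H. *)
Definition prop_re {R : realType} {d : nat} (psi : nat -> Zd d -> R) (E : nat -> R)
  (t : R) (x y : Zd d) : R :=
  limn (series (fun n => cos (t * E n) * psi n x * psi n y)).
Definition prop_im {R : realType} {d : nat} (psi : nat -> Zd d -> R) (E : nat -> R)
  (t : R) (x y : Zd d) : R :=
  limn (series (fun n => sin (t * E n) * psi n x * psi n y)).
Definition prop_abs {R : realType} {d : nat} (psi : nat -> Zd d -> R) (E : nat -> R)
  (t : R) (x y : Zd d) : R :=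
  Num.sqrt (prop_re psi E t x y ^+ 2 + prop_im psi E t x y ^+ 2).

(* e^{-(1/800)|ln eps| r}, with the convention |ln 0| = +oo
   (so the value is 1 if r = 0 and 0 if r > 0 when eps = 0). *)
Definition decay_bound {R : realType} (eps : R) (r : nat) : R :=
  if eps == 0 then (if r == 0%N then 1 else 0)
  else expR (- (800%:R)^-1 * `| ln eps | * r%:R).

(* Main.v *)
From mathcomp Require Import fingroup perm complex.
Require Import Defs.
From HB Require Import structures.
From mathcomp Require Import all_boot all_order all_algebra.
From mathcomp Require Import all_classical all_reals all_analysis.
From mathcomp Require Import zify ring lra.
Set Implicit Arguments.
Unset Strict Implicit.
Unset Printing Implicit Defensive.
Import Order.TTheory GRing.Theory Num.Theory.
Local Open Scope ring_scope.

(** Approximating [w] by rationals with denominator [q] replaces [Z^d] by the cyclic group [Z/q], on which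
    the potential is increasing and the hopping translation invariant. Translating by [a] raises the
    potential except at [a] sites, so by Courant-Fischer the ordered eigenvalues satisfy
    [lam_(k+a) - lam_k >= L * a / q]: the small divisors are bounded below without perturbation theory.
    Following the eigenvectors as the coupling grows from 0, one sees that [lam_k] stays attached to site
    [k]. At energy [lam_k] the sites are eliminated in order of decreasing size of their effective diagonal
    entry; a site that survives at scale [sig] carries a quasi-mode, hence an eigenvalue within [4 * sig] of
    [lam_k], so the Diophantine condition keeps the survivors far apart and the off-diagonal part decays
    faster than the divisors. All bounds are uniform in [q]; an ultrafilter limit gives exponentially
    localized modes on [Z^d], which are complete because they are diagonally dominant for the sup norm.
    The spectrum is simple, so every eigenbasis consists of these modes and the kernel of [e^(itH)] is
    bounded by a sum of products of two decaying modes. *)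

(** * Real symmetric matrices *)

(** The potential is unbounded and only its monotonicity is quantitative, so no size of [v] may
    enter an estimate; a large diagonal entry merely makes a site easier to eliminate. Small
    divisors are met only as differences of exact eigenvalues of a finite matrix: working at the
    energy [lam k] itself, rather than at an approximate energy corrected from scale to scale, lets
    the pairing with eigenvectors recognise which eigenvalue a surviving site stands for, and makes
    site [k] survive every scale. This needs eigenvector [i] to be concentrated at site [i]
    beforehand ([9 / 10]), which is close to what is to be proved. The circle is broken by
    continuity in the coupling: the gaps of the ordered spectrum hold at every coupling, so a small
    increase costs little, and the decay estimate then restores a better constant ([95 / 100]). The
    number of increments depends on [q], the resulting bounds do not. The cyclic group resembles the
    lattice only up to a radius growing with [q]; hence the limit is taken entry by entry, and
    completeness is proved directly on the lattice. *)

Lemma symmetric_eigenvector (R : rcfType) n (A : 'M[R]_n.+1) :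
  A^T = A -> exists a (v : 'rV[R]_n.+1), v *m v^T = 1%:M /\ v *m A = a *: v.
Proof.
move=> symA; pose f := real_complex R; pose A' := map_mx f A.
have hA : A' \is hermsymmx.
  apply: realsym_hermsym.
    apply/is_hermitianmxP; rewrite expr0 scale1r.
    by rewrite map_mx_id // /A' map_trmx symA.
  by apply/mxOverP => i j; rewrite mxE complex_real.
have [Dr defA Pu] : [/\ spectral_diag A' 0 0 \is Num.real,
   A' = invmx (spectralmx A') *m diag_mx (spectral_diag A') *m spectralmx A'
   & spectralmx A' \in unitmx].
  split; last exact: spectral_unit.
    by have /mxOverP := hermitian_spectral_diag_real hA; apply.
  by have /orthomx_spectralP := hermitian_normalmx hA.
move: (spectralmx A') (spectral_diag A') Dr defA Pu => P D Dr defA Pu.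
have ev : eigenvalue A' (D 0 0).
  apply/eigenvalueP; exists (row 0 P).
    have -> : row 0 P *m A' = row 0 (diag_mx D *m P).
      by rewrite -row_mul defA !mulmxA mulmxV // mul1mx.
    by rewrite row_mul row_diag_mx -scalemxAl -rowE.
  apply/eqP => h; have := row_free_unit P; rewrite Pu => /row_freeP[B PB].
  have : row 0 P *m B = row 0 1%:M by rewrite -row_mul PB.
  rewrite h mul0mx => /matrixP /(_ 0 0); rewrite !mxE eqxx /= => /eqP.
  by rewrite eq_sym oner_eq0.
(* The complex eigenvalue is real, hence a root of the real characteristic polynomial, which yields
   a real eigenvector. *)
move: ev; rewrite -(RRe_real Dr) eigenvalue_root_char -map_char_poly fmorph_root.
rewrite -eigenvalue_root_char => /eigenvalueP[w wA w0].
exists (complex.Re (D 0 0)).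
have ww : 0 < (w *m w^T) 0 0.
  have -> : (w *m w^T) 0 0 = \sum_i w 0 i ^+ 2.
    by rewrite mxE; apply: eq_bigr => i _; rewrite mxE expr2.
  rewrite lt_neqAle sumr_ge0 ?andbT; last by move=> i _; exact: sqr_ge0.
  apply: contraNneq w0 => /esym /eqP; rewrite psumr_eq0; last by move=> i _; exact: sqr_ge0.
  move=> /allP h; apply/eqP/rowP => i; rewrite mxE.
  by have := h i (mem_index_enum _); rewrite /= sqrf_eq0 => /eqP.
exists ((Num.sqrt ((w *m w^T) 0 0))^-1 *: w); split; last first.
  by rewrite -scalemxAl wA !scalerA mulrC.
rewrite linearZ /= -scalemxAl -scalemxAr scalerA -expr2 exprVn sqr_sqrtr ?ltW //.
by rewrite [X in _ *: X]mx11_scalar scale_scalar_mx mulVf ?gt_eqF.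
Qed.

(** The reflection in the hyperplane orthogonal to [e - v] exchanges the unit vectors [e] and [v];
    it degenerates to the identity when they coincide. *)
Lemma householder (R : rcfType) n (v : 'rV[R]_n.+1) : v *m v^T = 1%:M ->
  exists Q : 'M[R]_n.+1, Q *m Q^T = 1%:M /\ row 0 Q = v.
Proof.
move=> v1; pose e : 'rV[R]_n.+1 := delta_mx 0 0; pose w := e - v.
have ee : e *m e^T = 1%:M.
  by rewrite /e trmx_delta mul_delta_mx; apply/matrixP => i j; rewrite !mxE !ord1.
have [w0|w0] := eqVneq w 0.
  exists 1%:M; split; first by rewrite trmx1 mulmx1.
  by rewrite rowE mulmx1; apply/eqP; rewrite -subr_eq0 -/w w0.
pose s := (w *m w^T) 0 0.
have sE : w *m w^T = s%:M by rewrite -mx11_scalar.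
have s0 : s != 0.
  apply: contraNneq w0 => s0; apply/eqP/rowP => i; rewrite [RHS]mxE.
  have : \sum_i w 0 i ^+ 2 = 0.
    by rewrite -[RHS]s0 /s mxE; apply: eq_bigr => k _; rewrite [X in _ = _ * X]mxE expr2.
  move/eqP; rewrite psumr_eq0; last by move=> k _; exact: sqr_ge0.
  by move=> /allP /(_ i (mem_index_enum _)); rewrite /= sqrf_eq0 => /eqP.
have ve : v *m e^T = e *m v^T.
  by apply/matrixP => i j; rewrite !ord1 [LHS]mxE [RHS]mxE; apply: eq_bigr => k _; rewrite mxE [v^T _ _]mxE mulrC.
have ew : e *m w^T = (s / 2)%:M.
  have : w *m w^T = e *m w^T + e *m w^T.
    by rewrite /w linearB /= mulmxBl !mulmxBr ee v1 ve opprB addrA addrAC.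
  rewrite sE [e *m w^T]mx11_scalar; set x := (_ *m _) 0 0 => /matrixP/(_ 0 0).
  rewrite !mxE eqxx !mulr1n => ->; congr (_%:M); lra.
pose Q : 'M[R]_n.+1 := 1%:M - (2 / s) *: (w^T *m w).
have QT : Q^T = Q by rewrite /Q linearB /= trmx1 linearZ /= trmx_mul trmxK.
exists Q; split.
  have WW : (w^T *m w) *m (w^T *m w) = s *: (w^T *m w).
    by rewrite mulmxA -[w^T *m w *m w^T]mulmxA sE mul_mx_scalar scalemxAl.
  rewrite QT /Q; move: WW; set W := w^T *m w => WW.
  rewrite mulmxBl !mulmxBr !mul1mx mulmx1 -scalemxAl -scalemxAr WW.
  rewrite !scalerA; have -> : 2 / s * (2 / s) * s = 2 / s + 2 / s :> R by field.
  by rewrite scalerDl opprB addrK subrK.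
rewrite rowE mulmxBr mulmx1 -scalemxAr mulmxA ew mul_scalar_mx scalerA.
have -> : 2 / s * (s / 2) = 1 by field.
by rewrite scale1r /w opprB addrC subrK.
Qed.

(** Deflation: in an orthonormal basis starting with an eigenvector the first row is a multiple of
    the first basis vector, and by symmetry so is the first column, so a smaller symmetric block
    remains. *)
Lemma symmetric_spectral (R : rcfType) n (A : 'M[R]_n) : A^T = A ->
  exists (P : 'M[R]_n) (D : 'rV[R]_n), P *m P^T = 1%:M /\ P *m A = diag_mx D *m P.
Proof.
elim: n A => [|n IH] A symA.
  by exists 1%:M, 0; split; apply/matrixP => -[].
have [a [v [v1 vA]]] := symmetric_eigenvector symA.
have [Q [QQ rQ]] := householder v1.
have QQ' : Q^T *m Q = 1%:M by apply: mulmx1C.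
pose B : 'M[R]_(1 + n) := Q *m A *m Q^T.
have symB : B^T = B by rewrite /B !trmx_mul trmxK symA mulmxA.
have QA : Q *m A = B *m Q by rewrite /B -[RHS]mulmxA QQ' mulmx1.
have rB : row 0 B = a *: delta_mx 0 0.
  by rewrite /B !row_mul rQ vA -scalemxAl -rQ -row_mul QQ row1.
clearbody B.
have B0 j : B 0 j = a * (j == 0)%:R.
  by have /rowP/(_ j) := rB; rewrite !mxE eqxx /=.
have [P [D [PP PA]]] : exists (P : 'M[R]_n) (D : 'rV[R]_n),
    P *m P^T = 1%:M /\ P *m drsubmx B = diag_mx D *m P.
  by apply: IH; rewrite trmx_drsub symB.
have defB : B = block_mx a%:M 0 0 (drsubmx B).
  rewrite -[LHS]submxK; congr block_mx.
  - rewrite [LHS]mx11_scalar; congr (_%:M); rewrite !mxE.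
    have -> : lshift n 0 = 0 :> 'I_(1 + n) by apply: val_inj.
    by rewrite B0 eqxx mulr1.
  - apply/matrixP => i j; rewrite !mxE ord1.
    have -> : lshift n 0 = 0 :> 'I_(1 + n) by apply: val_inj.
    by rewrite B0 mulr0.
  - apply/matrixP => i j; rewrite !mxE ord1 -[B]symB mxE.
    have -> : lshift n 0 = 0 :> 'I_(1 + n) by apply: val_inj.
    by rewrite B0 mulr0.
pose P' : 'M[R]_(1 + n) := block_mx 1%:M 0 0 P.
have PP' : P' *m P'^T = 1%:M.
  rewrite /P' tr_block_mx !trmx0 trmx1 mulmx_block !mulmx0 !mul0mx !mulmx1 !addr0 add0r PP.
  by rewrite -scalar_mx_block.
have PB : P' *m B = diag_mx (row_mx (a%:M : 'M[R]_1) D) *m P'.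
  rewrite defB diag_mx_row /P' !mulmx_block !mulmx0 !mul0mx !addr0 !add0r !mulmx1 !mul1mx PA.
  by congr block_mx; apply/matrixP => i j; rewrite !ord1 !mxE eqxx mulr1n.
exists (P' *m Q), (row_mx (a%:M : 'M[R]_1) D); split.
  by rewrite trmx_mul mulmxA -[X in X *m _]mulmxA QQ mulmx1 PP'.
by rewrite -mulmxA QA !mulmxA PB.
Qed.

(** Eigenvectors are rows and share their index type with the sites, so that [P k k] can measure how
    much the [k]-th eigenvector in increasing order of energy sits at site [k]. *)
Definition eigensystem (R : realFieldType) n (H P : 'M[R]_n) (lam : 'I_n -> R) :=
  [/\ P *m P^T = 1%:M, forall k, row k P *m H = lam k *: row k P
    & forall i j : 'I_n, (i <= j)%N -> lam i <= lam j].

Lemma symmetric_eigensystem (R : rcfType) n (H : 'M[R]_n) :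
  H^T = H -> exists P lam, eigensystem H P lam.
Proof.
move=> /symmetric_spectral[P [D [PP PH]]].
pose s := [tuple D 0 i | i < n].
have /tuple_permP[p sp] : perm_eq (sort_tuple <=%O s) s by rewrite /= perm_sort.
exists (row_perm p P), (fun i => D 0 (p i)); split.
- by rewrite tr_row_perm row_permE col_permE mulmxA -[_ *m P *m _]mulmxA PP mulmx1 -perm_mxM mulgV perm_mx1.
- move=> k; have -> : row k (row_perm p P) = row (p k) P by apply/rowP => j; rewrite !mxE.
  by rewrite -row_mul PH row_mul row_diag_mx -scalemxAl -rowE.
- have st i : D 0 (p i) = tnth (sort_tuple <=%O s) i.
    have -> : sort_tuple <=%O s = [tuple tnth s (p j) | j < n] by apply: val_inj.
    by rewrite tnth_mktuple /s tnth_mktuple.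
  move=> i j ij; rewrite !st !(tnth_nth 0) /=.
  apply: sorted_leq_nth => //; first exact: le_trans.
    by apply: sort_sorted; exact: le_total.
    by rewrite inE size_sort size_map size_enum_ord.
  by rewrite inE size_sort size_map size_enum_ord.
Qed.

Lemma eigensystem_quad (R : realFieldType) n (H P : 'M[R]_n) lam (u : 'rV[R]_n) :
  eigensystem H P lam ->
  (u *m H *m u^T) 0 0 = \sum_l lam l * (u *m P^T) 0 l ^+ 2.
Proof.
move=> [PP PH _]; have PP' : P^T *m P = 1%:M by apply: mulmx1C.
have dH : P *m H = diag_mx (\row_l lam l) *m P.
  by apply/row_matrixP => k; rewrite !row_mul row_diag_mx PH mxE -scalemxAl -rowE.
have -> : u *m H *m u^T = (u *m P^T) *m diag_mx (\row_l lam l) *m (u *m P^T)^T.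
  by rewrite trmx_mul trmxK -!mulmxA [diag_mx _ *m _]mulmxA -dH !mulmxA -[u *m P^T *m P]mulmxA PP' mulmx1.
rewrite mxE; apply: eq_bigr => l _; rewrite mul_mx_diag.
set x := u *m P^T; rewrite !mxE; ring.
Qed.

Lemma orthogonal_norm (R : realFieldType) n (P : 'M[R]_n) (u : 'rV[R]_n) :
  P *m P^T = 1%:M -> (u *m u^T) 0 0 = \sum_l (u *m P^T) 0 l ^+ 2.
Proof.
move=> PP; have PP' : P^T *m P = 1%:M by apply: mulmx1C.
have -> : u *m u^T = (u *m P^T) *m (u *m P^T)^T.
  by rewrite trmx_mul trmxK !mulmxA -[u *m P^T *m P]mulmxA PP' mulmx1.
by rewrite mxE; apply: eq_bigr => l _; rewrite [X in _ * X]mxE expr2.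
Qed.

(* Courant-Fischer: a nonzero vector in the span of the lowest [i + 1] eigenvectors of [A] can be chosen to
   satisfy the [m] constraints [F] and to be sent by [S] orthogonally to the lowest [k] eigenvectors of [B]. *)
Lemma eigenvalue_comparison (R : realFieldType) n m (A B S : 'M[R]_n) (F : 'M[R]_(n, m))
    PA a PB b c (i k : 'I_n) :
  eigensystem A PA a -> eigensystem B PB b ->
  (forall u : 'rV[R]_n, u *m F = 0 ->
    (u *m S *m (u *m S)^T) 0 0 = (u *m u^T) 0 0 /\
    (u *m S *m B *m (u *m S)^T) 0 0 + c * (u *m u^T) 0 0 <= (u *m A *m u^T) 0 0) ->
  (k + m <= i)%N -> b k + c <= a i.
Proof.
move=> eA eB FS kmi; have [PA1 _ amon] := eA; have [PB1 _ bmon] := eB.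
pose fi (l : 'I_i.+1) : 'I_n := widen_ord (ltn_ord i) l.
pose fk (l : 'I_k) : 'I_n := widen_ord (ltnW (ltn_ord k)) l.
pose U := rowsub fi PA; pose V := rowsub fk PB.
pose G : 'M[R]_(i.+1, m + k) := row_mx (U *m F) (U *m S *m V^T).
(* [G] has [i + 1] rows and [m + k <= i] columns, so its left kernel is nonzero. *)
have [w wG w0] : exists2 w : 'rV[R]_i.+1, w *m G = 0 & w != 0.
  have : kermx G != 0.
    rewrite kermx_eq0; apply/negP => /eqP rG.
    by have := rank_leq_col G; rewrite rG leqNgt ltnS addnC kmi.
  case/rowV0Pn => w /sub_kermxP wG w0; by exists w.
have [wF wV] : w *m U *m F = 0 /\ w *m U *m S *m V^T = 0.
  move: wG; rewrite mul_mx_row -[0 in RHS]row_mx0 => /eq_row_mx[h1 h2].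
  by rewrite -!mulmxA; rewrite !mulmxA in h1 h2 *.
set u := w *m U in wF wV.
have uPA l : (u *m PA^T) 0 l = \sum_(j | fi j == l) w 0 j.
  rewrite /u -mulmxA; have -> : U *m PA^T = rowsub fi 1%:M.
    by rewrite -PA1 mul_rowsub_mx.
  rewrite mxE [RHS]big_mkcond /=; apply: eq_bigr => j _; rewrite !mxE.
  by case: eqP => _; rewrite ?mulr1 ?mulr0.
have hi (l : 'I_n) : (i < l)%N -> (u *m PA^T) 0 l = 0.
  move=> il; rewrite uPA big1 // => j /eqP jl; move: il.
  by rewrite -jl /= ltnNge -ltnS ltn_ord.
have u0 : 0 < (u *m u^T) 0 0.
  rewrite (orthogonal_norm u PA1) lt_neqAle sumr_ge0 ?andbT; last by move=> l _; exact: sqr_ge0.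
  apply: contraNneq w0 => /esym/eqP; rewrite psumr_eq0; last by move=> l _; exact: sqr_ge0.
  move=> /allP h; apply/eqP/rowP => j; rewrite [RHS]mxE.
  have := h (fi j) (mem_index_enum _); rewrite /= sqrf_eq0 uPA => /eqP.
  rewrite (big_pred1 j) // => j'; rewrite /= -val_eqE /=; exact: val_eqE.
have lo (l : 'I_n) : (l < k)%N -> (u *m S *m PB^T) 0 l = 0.
  move=> lk; have /rowP/(_ (Ordinal lk)) := wV; rewrite [RHS]mxE => <-.
  rewrite [LHS]mxE [RHS]mxE; apply: eq_bigr => j _; congr (_ * _); rewrite !mxE.
  by congr (PB _ _); apply: val_inj.
have [uS uAB] := FS u wF.
have le1 : b k * (u *m u^T) 0 0 <= (u *m S *m B *m (u *m S)^T) 0 0.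
  rewrite (eigensystem_quad _ eB) -uS (orthogonal_norm _ PB1) mulr_sumr; apply: ler_sum => l _.
  have [lk|kl] := ltnP l k; first by rewrite lo // expr0n /= !mulr0.
  by apply: ler_wpM2r; [exact: sqr_ge0|exact: bmon].
have le2 : (u *m A *m u^T) 0 0 <= a i * (u *m u^T) 0 0.
  rewrite (eigensystem_quad _ eA) (orthogonal_norm _ PA1) mulr_sumr; apply: ler_sum => l _.
  have [il|li] := ltnP i l; first by rewrite hi // expr0n /= !mulr0.
  by apply: ler_wpM2r; [exact: sqr_ge0|exact: amon].
rewrite -(ler_pM2r u0) mulrDl; apply: le_trans le2; apply: le_trans uAB.
by rewrite lerD2r.
Qed.

(** * Elimination of the non-resonant sites *)

(** With weights [expR (rho * d x y)] a finite bound encodes exponential off-diagonal decay at rate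
    [rho]. Columns are measured one at a time, not through their supremum, because only the columns
    of the resonant set are controlled after an elimination. *)
Definition colnorm (R : realFieldType) n (w : 'I_n -> 'I_n -> R) (A : 'M[R]_n) (y : 'I_n) : R :=
  \sum_x `|A x y| * w x y.

Section ColumnNorm.
Variables (R : realFieldType) (n : nat) (w : 'I_n -> 'I_n -> R).
Hypothesis w_ge1 : forall x y, 1 <= w x y.
Hypothesis w_mul : forall x y z, w x z <= w x y * w y z.
Implicit Types A B : 'M[R]_n.

Let w_ge0 x y : 0 <= w x y.
Proof. exact: le_trans (w_ge1 x y). Qed.

Lemma colnorm_ge0 A y : 0 <= colnorm w A y.
Proof. by apply: sumr_ge0 => x _; apply: mulr_ge0. Qed.

Lemma colnormD A B y : colnorm w (A + B) y <= colnorm w A y + colnorm w B y.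
Proof.
rewrite -big_split; apply: ler_sum => x _; rewrite /= -mulrDl; apply: ler_wpM2r => //.
by rewrite mxE ler_normD.
Qed.

Lemma colnormN A y : colnorm w (- A) y = colnorm w A y.
Proof. by apply: eq_bigr => x _; rewrite mxE normrN. Qed.

Lemma colnormM A B y a : (forall z, B z y != 0 -> colnorm w A z <= a) ->
  colnorm w (A *m B) y <= a * colnorm w B y.
Proof.
move=> hA; apply: (@le_trans _ _ (\sum_x \sum_z `|A x z| * `|B z y| * w x y)).
  apply: ler_sum => x _; rewrite -mulr_suml; apply: ler_wpM2r => //.
  by rewrite mxE (le_trans (ler_norm_sum _ _ _))// ler_sum // => z _; rewrite normrM.
rewrite exchange_big /= /colnorm mulr_sumr; apply: ler_sum => z _.
have [->|Bz] := eqVneq (B z y) 0.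
  by rewrite big1 ?normr0 ?mul0r ?mulr0 // => x _; rewrite mulr0 mul0r.
apply: (@le_trans _ _ (colnorm w A z * (`|B z y| * w z y))); last first.
  by apply: ler_wpM2r; [exact: mulr_ge0|exact: hA].
rewrite mulr_suml; apply: ler_sum => x _; rewrite -mulrA -mulrA.
apply: ler_wpM2l => //; rewrite mulrCA; exact: ler_wpM2l.
Qed.

(** A kernel vector satisfies [v = - A v], while [A] contracts the unweighted [l^1] norm since the
    weights are at least 1. *)
Lemma colnorm_lt1_unit A a : a < 1 -> (forall z, colnorm w A z <= a) -> 1%:M + A \in unitmx.
Proof.
move=> a1 hA; rewrite -unitmx_tr -row_free_unit -kermx_eq0; apply/negP => /negP/rowV0Pn.
case=> v /sub_kermxP vA v0; apply/negP: v0; rewrite negbK.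
have vE x : v 0 x = - \sum_z A x z * v 0 z.
  have /rowP/(_ x) := vA; rewrite linearD /= trmx1 mulmxDr mulmx1 !mxE.
  move/eqP; rewrite addr_eq0 => /eqP ->; congr (- _); apply: eq_bigr => z _.
  by rewrite mxE mulrC.
have le1 : \sum_x `|v 0 x| <= a * \sum_x `|v 0 x|.
  rewrite mulr_sumr; apply: (@le_trans _ _ (\sum_x \sum_z `|A x z| * `|v 0 z|)).
    apply: ler_sum => x _; rewrite vE normrN (le_trans (ler_norm_sum _ _ _))//.
    by apply: ler_sum => z _; rewrite normrM.
  rewrite exchange_big /=; apply: ler_sum => z _; rewrite -mulr_suml; apply: ler_wpM2r => //.
  apply: le_trans (hA z); apply: ler_sum => x _; exact: ler_peMr.
have s0 : \sum_x `|v 0 x| = 0.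
  apply/eqP; rewrite eq_le sumr_ge0 ?andbT // leNgt; apply/negP => sp.
  by move: le1; rewrite -ler_pdivrMr // divff ?gt_eqF // leNgt a1.
apply/eqP/rowP => x; rewrite [RHS]mxE; apply/eqP; rewrite -normr_eq0.
by move/eqP: s0; rewrite psumr_eq0 // => /allP/(_ x (mem_index_enum _)).
Qed.

End ColumnNorm.

Definition offdiag (R : realFieldType) n (M : 'M[R]_n) : 'M[R]_n :=
  \matrix_(x, y) if x == y then 0 else M x y.

(* The data of one scale of the resolvent expansion at energy [E]: on the columns indexed by the resonant
   set [S], [Phi] holds quasi-modes and [M] the Schur complement of [H - E] onto [S]. *)
Record reduced (R : realFieldType) n (w : 'I_n -> 'I_n -> R) (H : 'M[R]_n) (E b F : R)
    (S : {set 'I_n}) (Phi M : 'M[R]_n) : Prop := Reduced {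
  reduced_mul : forall x y, y \in S -> ((H - E%:M) *m Phi) x y = M x y;
  reduced_out : forall x y, x \notin S -> y \in S -> M x y = 0;
  reduced_off : forall y, y \in S -> colnorm w (offdiag M) y <= b;
  reduced_mode : forall y, y \in S -> colnorm w (Phi - 1%:M) y <= F }.

Section SchurStep.
Variables (R : realFieldType) (n : nat) (H P : 'M[R]_n) (lam : 'I_n -> R) (k : 'I_n).
Hypothesis PP : P *m P^T = 1%:M.
Hypothesis PH : forall i, row i P *m H = lam i *: row i P.
Hypothesis Pdiag : forall i, 9 / 10 <= `|P i i|.
Variable (w : 'I_n -> 'I_n -> R).
Hypothesis w_ge1 : forall x y, 1 <= w x y.
Hypothesis w_id : forall x, w x x = 1.
Hypothesis w_mul : forall x y z, w x z <= w x y * w y z.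

Let w_ge0 x y : 0 <= w x y.
Proof. exact: le_trans (w_ge1 x y). Qed.

Lemma orthogonal_entry_le1 x y : `|P x y| <= 1.
Proof.
have : \sum_z P x z ^+ 2 = 1.
  have /matrixP/(_ x x) := PP; rewrite !mxE eqxx mulr1n => <-.
  by apply: eq_bigr => z _; rewrite mxE expr2.
rewrite (bigD1 y) //= => h; rewrite -(@ler_pXn2r _ 2) ?nnegrE // expr1n real_normK ?num_real //.
by rewrite -h lerDl sumr_ge0 // => z _; exact: sqr_ge0.
Qed.

(** Moving [H] onto the eigenvector turns each identity for the reduced matrix into information on
    an exact eigenvalue; no resolvent has to be estimated. *)
Lemma eigenvector_pairing (Phi : 'M[R]_n) E i y :
  \sum_x P i x * ((H - E%:M) *m Phi) x y = (lam i - E) * \sum_x P i x * Phi x y.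
Proof.
have e1 : row i P *m (H - E%:M) *m Phi = (lam i - E) *: (row i P *m Phi).
  by rewrite mulmxBr PH mul_mx_scalar -scalerBl -scalemxAl.
have /rowP/(_ y) := e1; rewrite -mulmxA [LHS]mxE [RHS]mxE [X in _ = _ * X]mxE => h.
transitivity (\sum_j (row i P) 0 j * ((H - E%:M) *m Phi) j y).
  by apply: eq_bigr => x _; rewrite [row i P _ _]mxE.
by rewrite h; congr (_ * _); apply: eq_bigr => x _; rewrite mxE.
Qed.

Lemma mode_pairing (Phi : 'M[R]_n) y F : F <= 1 / 10 -> colnorm w (Phi - 1%:M) y <= F ->
  8 / 10 <= `|\sum_x P y x * Phi x y|.
Proof.
move=> F1 hF.
have -> : \sum_x P y x * Phi x y = P y y + \sum_x P y x * (Phi - 1%:M) x y.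
  rewrite (eq_bigr (fun x => P y x * (Phi - 1%:M) x y + P y x * (x == y)%:R)); last first.
    by move=> x _; rewrite !mxE; ring.
  rewrite big_split /= addrC; congr (_ + _).
  rewrite (bigD1 y) //= eqxx mulr1 big1 ?addr0 // => x /negbTE ->; exact: mulr0.
have h2 : `|\sum_x P y x * (Phi - 1%:M) x y| <= 1 / 10.
  apply: le_trans F1; apply: le_trans hF; rewrite (le_trans (ler_norm_sum _ _ _)) //.
  apply: ler_sum => x _; rewrite normrM mulrC; apply: ler_pM => //.
  by apply: le_trans (w_ge1 _ _); exact: orthogonal_entry_le1.
have := Pdiag y; have := lerB_normD (P y y) (\sum_x P y x * (Phi - 1%:M) x y); lra.
Qed.

(** Pair column [y] with eigenvector [y]: their overlap is at least [8 / 10], and the other side is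
    a column of [M]. A small effective diagonal entry thus pins [lam y] near [E], which converts
    separation of eigenvalues into spacing of sites. *)
Lemma eigenvalue_near_mode E b F S Phi M y : reduced w H E b F S Phi M -> F <= 1 / 10 ->
  y \in S -> 8 / 10 * `|lam y - E| <= `|M y y| + b.
Proof.
move=> [h1 h2 h3 h4] F1 yS.
have hm := mode_pairing F1 (h4 y yS).
have := eigenvector_pairing Phi E y y.
rewrite (eq_bigr (fun x => P y x * M x y)); last by move=> x _; rewrite h1.
rewrite (bigD1 y) //= => /(congr1 Num.norm); rewrite normrM => h.
have le1 : 8 / 10 * `|lam y - E| <= `|lam y - E| * `|\sum_x P y x * Phi x y|.
  by rewrite mulrC; apply: ler_wpM2l.
apply: le_trans le1 _; rewrite -h (le_trans (ler_normD _ _)) //; apply: lerD.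
  by rewrite normrM ler_piMl // orthogonal_entry_le1.
apply: le_trans (h3 y yS); rewrite (le_trans (ler_norm_sum _ _ _)) // /colnorm [leRHS](bigD1 y) //=.
rewrite !mxE eqxx normr0 mul0r add0r; apply: ler_sum => x /negbTE xy.
rewrite !mxE xy normrM mulrC; apply: ler_pM => //.
by apply: le_trans (w_ge1 _ _); exact: orthogonal_entry_le1.
Qed.

(** At [E = lam k] the pairing with eigenvector [k] vanishes, so the diagonal entry is balanced by
    the off-diagonal ones. This is what keeps [k] from ever being eliminated. *)
Lemma center_small b F S Phi M : reduced w H (lam k) b F S Phi M -> k \in S ->
  9 / 10 * `|M k k| <= b.
Proof.
move=> [h1 h2 h3 h4] kS; have := eigenvector_pairing Phi (lam k) k k.
rewrite subrr mul0r (eq_bigr (fun x => P k x * M x k)); last by move=> x _; rewrite h1.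
rewrite (bigD1 k) //= => /eqP; rewrite addr_eq0 => /eqP /(congr1 Num.norm).
rewrite normrN normrM => h.
apply: (@le_trans _ _ (`|P k k| * `|M k k|)); first by apply: ler_wpM2r.
rewrite h; apply: le_trans (h3 k kS).
rewrite (le_trans (ler_norm_sum _ _ _)) // /colnorm [leRHS](bigD1 k) //=.
rewrite !mxE eqxx normr0 mul0r add0r; apply: ler_sum => x /negbTE xy.
rewrite !mxE xy normrM mulrC; apply: ler_pM => //.
by apply: le_trans (w_ge1 _ _); exact: orthogonal_entry_le1.
Qed.

Lemma reduced_step sig F (S : {set 'I_n}) Phi M :
  0 < sig -> sig <= 1 / 4 -> F <= 1 / 10 -> k \in S ->
  reduced w H (lam k) (sig ^+ 2) F S Phi M ->
  exists (S' : {set 'I_n}) Phi' M',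
    [/\ reduced w H (lam k) (2 * sig ^+ 2) (F + 4 * sig) S' Phi' M', k \in S'
      & forall y, y \in S' -> `|lam y - lam k| <= 4 * sig].
Proof.
move=> s0 s1 F1 kS red; have [h1 h2 h3 h4] := red.
(* Diagonal entries on [N] are at least [sig] while the off-diagonal column norms are at most
   [sig ^+ 2]: the relative size [sig] makes the block on [N] invertible. *)
pose S' := [set y in S | `|M y y| < sig]; pose N := S :\: S'.
have NS y : y \in N -> y \in S by rewrite inE => /andP[].
have S'S y : y \in S' -> y \in S by rewrite inE => /andP[].
have NM y : y \in N -> sig <= `|M y y|.
  by rewrite !inE => /andP[h yS]; move: h; rewrite yS /= -leNgt.
(* On [N] the block of [M] is its diagonal times [1 + A], and [Y] is the coupling to [S'] divided by
   the same diagonal. Then [X] solves the block equation on [N], and [M - M *m X] is the Schur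
   complement. *)
pose A : 'M[R]_n := \matrix_(x, z) if (x \in N) && (z \in N) && (x != z) then M x z / M x x else 0.
pose Y : 'M[R]_n := \matrix_(x, z) if (x \in N) && (z \in S') then M x z / M x x else 0.
have cb (B : 'M[R]_n) z : z \in S ->
    (forall x, B x z = 0 \/ [/\ x \in N, x != z & B x z = M x z / M x x]) -> colnorm w B z <= sig.
  move=> zS hB; apply: (@le_trans _ _ (sig^-1 * colnorm w (offdiag M) z)); last first.
    by rewrite mulrC ler_pdivrMr // -expr2 h3.
  rewrite /colnorm mulr_sumr; apply: ler_sum => x _; rewrite mulrA; apply: ler_wpM2r => //.
  case: (hB x) => [->|[xN xz ->]]; first by rewrite normr0 mulr_ge0 // invr_ge0 ltW.
  rewrite mxE (negbTE xz) normrM mulrC; apply: ler_wpM2r => //.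
  rewrite normfV lef_pV2 ?posrE ?NM //; exact: lt_le_trans (NM _ xN).
have cA z : colnorm w A z <= sig.
  have [zN|zN] := boolP (z \in N); last first.
    rewrite /colnorm big1 ?ltW // => x _; rewrite mxE (negbTE zN) andbF /= normr0 mul0r //.
  apply: cb => [|x]; first exact: NS.
  rewrite mxE zN andbT; case: ifP => [/andP[xN xz]|_]; [by right|by left].
have cY z : z \in S' -> colnorm w Y z <= sig.
  move=> zS'; apply: cb => [|x]; first exact: S'S.
  rewrite mxE zS' andbT; case: ifP => [xN|_]; [right|by left]; split => //.
  by apply: contraTneq xN => ->; rewrite inE zS'.
have uA : 1%:M + A \in unitmx.
  by apply: (colnorm_lt1_unit w_ge1 _ cA); lra.
pose X := invmx (1%:M + A) *m Y.
have XE : X = Y - A *m X.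
  have : (1%:M + A) *m X = Y by rewrite /X mulmxA mulmxV // mul1mx.
  by rewrite mulmxDl mul1mx => <-; rewrite addrK.
have XN x y : x \notin N -> X x y = 0.
  move=> xN; rewrite XE !mxE (negbTE xN) /= sub0r big1 ?oppr0 // => z _.
  by rewrite !mxE (negbTE xN) /= mul0r.
clearbody X.
have cX y : y \in S' -> colnorm w X y <= 2 * sig.
  move=> yS'; have := colnormD w_ge1 Y (- (A *m X)) y; rewrite -XE colnormN.
  have := colnormM w_ge1 w_mul (y := y) (B := X) (fun z _ => cA z).
  have := cY y yS'; have := colnorm_ge0 w_ge1 X y.
  by set a := colnorm _ X _; set b := colnorm _ Y _; set c := colnorm _ (_ *m _) _; nra.
have XNz z y : X z y != 0 -> z \in N.
  by apply: contraNT => /XN ->.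
pose M' := M - M *m X; pose Phi' := Phi - Phi *m X.
(* On a row of [N] this is the equation [X + A *m X = Y], multiplied back by the diagonal entry of
   [M]. *)
have M'0 x y : x \notin S' -> y \in S' -> M' x y = 0.
  move=> xS' yS'; rewrite 3!mxE; have [xS|xS] := boolP (x \in S); last first.
    have -> : M x y = 0 by apply: h2 => //; exact: S'S.
    rewrite sub0r big1 ?oppr0 // => z _.
    have [zN|zN] := boolP (z \in N); first by rewrite h2 ?mul0r // NS.
    by rewrite XN // mulr0.
  have xN : x \in N by rewrite inE xS' xS.
  have Mx0 : M x x != 0 by rewrite -normr_gt0; apply: lt_le_trans (NM _ xN).
  have : M x y / M x x = Y x y by rewrite mxE xN yS'.
  have -> : Y = X + A *m X by rewrite {1}XE subrK.
  rewrite [RHS]mxE [(A *m X) x y]mxE => e.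
  have -> : M x y = M x x * (X x y + \sum_j A x j * X j y).
    by rewrite -e mulrC divfK.
  have -> : \sum_j A x j * X j y = \sum_(j | j != x) M x j / M x x * X j y.
    rewrite (bigD1 x) //= {1}/A mxE eqxx andbF mul0r add0r; apply: eq_bigr => z zx.
    rewrite mxE xN eq_sym zx andbT /=; case: ifP => zN //.
    by rewrite XN ?zN // !mulr0.
  rewrite [X in _ - X](bigD1 x) //= mulrDr opprD addrACA subrr add0r mulr_sumr -sumrB.
  rewrite big1 // => z zx; by rewrite mulrA [M x x * _]mulrC divfK // subrr.
exists S', Phi', M'; split.
- split=> // [x y yS'|y yS'|y yS'].
  + rewrite /Phi' /M' mulmxBr mulmxA [LHS]mxE [RHS]mxE h1 ?S'S //.
    congr (_ + _); rewrite [LHS]mxE [RHS]mxE; congr (- _); rewrite [LHS]mxE [RHS]mxE.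
    apply: eq_bigr => z _; have [zN|zN] := boolP (z \in N); first by rewrite h1 // NS.
    by rewrite XN // !mulr0.
  (* [X] is supported on rows of [N], so a row in [S'] meets it only through off-diagonal entries of
     [M]: the correction is at most [sig ^+ 2 * (2 * sig)]. *)
  + apply: (@le_trans _ _ (colnorm w (offdiag M - offdiag M *m X) y)).
      apply: ler_sum => x _; apply: ler_wpM2r => //.
      have [xS'|xS'] := boolP (x \in S'); last by rewrite [X in `|X|]mxE M'0 // if_same normr0.
      rewrite [X in `|X| <= _]mxE; case: eqP => [_|/eqP xy]; first by rewrite normr0.
      have -> : M' x y = (offdiag M) x y - \sum_j (offdiag M) x j * X j y; last first.
        by rewrite !mxE (negbTE xy).
      rewrite /M' 3!mxE [X in _ = X - _]mxE (negbTE xy); congr (_ - _); apply: eq_bigr => z _.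
      rewrite mxE; case: eqP => // xz; rewrite -xz XN ?mulr0 //.
      by rewrite inE xS'.
    apply: le_trans (colnormD w_ge1 _ _ _) _; rewrite colnormN.
    have hM : colnorm w (offdiag M *m X) y <= sig ^+ 2 * colnorm w X y.
      by apply: colnormM => // z /XNz /NS zS; exact: h3.
    have := h3 y (S'S _ yS'); have := cX y yS'; have := colnorm_ge0 w_ge1 X y.
    have : 0 <= sig ^+ 2 by exact: sqr_ge0.
    by move: hM; set a := colnorm _ _ _; set b := colnorm _ X _; set c := colnorm _ _ _; nra.
  + apply: (@le_trans _ _ (colnorm w (Phi - 1%:M) y + colnorm w (Phi *m X) y)).
      rewrite /Phi' addrAC -[colnorm w (Phi *m X) y]colnormN; exact: colnormD.
    apply: lerD; first exact/h4/S'S.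
    apply: (@le_trans _ _ (2 * colnorm w X y)); last by have := cX y yS'; lra.
    apply: colnormM => // z /XNz /NS zS.
    have -> : Phi = (Phi - 1%:M) + 1%:M by rewrite subrK.
    apply: le_trans (colnormD w_ge1 _ _ _) _.
    have -> : colnorm w 1%:M z = 1.
      rewrite /colnorm (bigD1 z) //= w_id !mxE eqxx normr1 mulr1 big1 ?addr0 // => x.
      by rewrite mxE => /negbTE ->; rewrite normr0 mul0r.
    by have := h4 z zS; lra.
- rewrite inE kS; have := center_small red kS.
  have h5 : sig ^+ 2 <= sig / 4 by rewrite expr2; apply: ler_wpM2l; lra.
  lra.
- move=> y yS'; have := eigenvalue_near_mode red F1 (S'S _ yS').
  have : `|M y y| < sig by move: yS'; rewrite inE => /andP[].
  have h5 : sig ^+ 2 <= sig / 4 by rewrite expr2; apply: ler_wpM2l; lra.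
  lra.
Qed.

End SchurStep.

(** The least distance between survivors of the initial scale. Lowering the decay rate by [rho / 4]
    at this distance gains [expR (2 * 16 ^+ m)] or more, enough for the factor [2 * 16 ^+ m] lost
    when passing to the next scale. *)
Definition scale_base (m : nat) : nat := (8 * 16 ^ m)%N.

(** * Multiscale iteration and exponential decay of the eigenvectors *)

Section Localization.
Variables (R : realType) (n : nat) (H P : 'M[R]_n) (lam : 'I_n -> R).
Hypothesis PP : P *m P^T = 1%:M.
Hypothesis PH : forall i, row i P *m H = lam i *: row i P.
Hypothesis Pdiag : forall i, 9 / 10 <= `|P i i|.
Variables (d : 'I_n -> 'I_n -> nat) (m : nat) (c sig rho : R).
Hypothesis d_id : forall x, d x x = 0%N.
Hypothesis d_triangle : forall x y z, (d x z <= d x y + d y z)%N.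
Hypothesis m_gt0 : (0 < m)%N.
Hypothesis c_gt0 : 0 < c.
Hypothesis separated : forall x y, x != y -> c <= `|lam x - lam y| * (d x y)%:R ^+ m.
Hypothesis sig_gt0 : 0 < sig.
Hypothesis sig_small : sig <= 1 / 80.
Hypothesis sig_base : 8 * sig * (scale_base m)%:R ^+ m <= c.
Hypothesis rho_ge1 : 1 <= rho.
Hypothesis H_off : forall y, colnorm (fun x y => expR (rho * (d x y)%:R)) (offdiag H) y <= sig ^+ 2.

(** Dividing [sg] by [4 ^ m] multiplies the spacing of the survivors by 4, because separation is
    measured with the power [m] of the distance. The rate given up at scale [s] is proportional to
    [2^-s]; against a spacing of order [4^s] it gains ever more, while the total loss is only
    [rho / 2]. *)
Let rate s : R := rho * (1 + 2^-1 ^+ s) / 2.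
Let wt s x y : R := expR (rate s * (d x y)%:R).
Let sg s : R := sig * (4^-1 ^+ m) ^+ s.

Let half_gt0 s : 0 < 2^-1 ^+ s :> R.
Proof. by rewrite exprn_gt0 // invr_gt0. Qed.

Let rate_ge s : rho / 2 <= rate s.
Proof. by rewrite /rate ler_pM2r ?invr_gt0 // ler_peMr ?lerDl ?ltW // (lt_le_trans _ rho_ge1). Qed.

Let rate_ge0 s : 0 <= rate s.
Proof. by apply: le_trans (rate_ge s); have := rho_ge1; lra. Qed.

Let wt_ge1 s x y : 1 <= wt s x y.
Proof. by rewrite -[leLHS](@expR0 R) ler_expR mulr_ge0. Qed.

Let wt_id s x : wt s x x = 1.
Proof. by rewrite /wt d_id mulr0 expR0. Qed.

Let wt_mul s x y z : wt s x z <= wt s x y * wt s y z.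
Proof. by rewrite /wt -expRD -mulrDr ler_expR ler_wpM2l // -natrD ler_nat. Qed.

Let wt_anti s x y : wt s.+1 x y <= wt s x y.
Proof.
rewrite ler_expR ler_wpM2r // /rate ler_pM2r ?invr_gt0 // ler_pM2l ?(lt_le_trans _ rho_ge1) //.
by rewrite lerD2l exprS; have := half_gt0 s; lra.
Qed.

Let sg_gt0 s : 0 < sg s.
Proof. by rewrite mulr_gt0 // !exprn_gt0 // invr_gt0. Qed.

Let sg_le s : sg s <= sig * 2^-1 ^+ s.
Proof.
rewrite ler_pM2l //; apply: lerXn2r; rewrite ?nnegrE ?exprn_ge0 ?invr_ge0 //.
case: m m_gt0 => // m' _; rewrite exprS; apply: (@le_trans _ _ (4^-1 * 1)); last by lra.
by rewrite ler_wpM2l ?invr_ge0 // exprn_ile1 ?invr_ge0 // invf_le1 // ler1n.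
Qed.

Let sg_small s : sg s <= 1 / 80.
Proof.
apply: le_trans (sg_le s) _; apply: le_trans sig_small; rewrite ler_piMr ?(ltW sig_gt0) //.
by rewrite exprn_ile1 ?invr_ge0 // invf_le1 // ler1n.
Qed.

Let far s x y : x != y -> `|lam x - lam y| <= 8 * sg s -> (scale_base m * 4 ^ s <= d x y)%N.
Proof.
move=> xy xys; rewrite -(leq_exp2r _ _ m_gt0) -(ler_nat R) natrX.
have e8 : 0 < 8 * sg s by rewrite mulr_gt0.
rewrite -(ler_pM2l e8); apply: (@le_trans _ _ c); last first.
  by apply: le_trans (separated xy) _; rewrite natrX; apply: ler_wpM2r => //; exact: exprn_ge0.
have ab : (4^-1 ^+ m) ^+ s * (4 ^+ s) ^+ m = 1 :> R.
  by rewrite -!exprM mulnC -exprMn mulVf ?expr1n // pnatr_eq0.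
apply: le_trans sig_base; rewrite natrM exprMn natrX /sg.
set u := (4^-1 ^+ m) ^+ s in ab *; set v := (4 ^+ s) ^+ m in ab *; set b := _ ^+ m.
have -> : 8 * (sig * u) * (b * v) = 8 * sig * b * (u * v) by ring.
by rewrite ab mulr1.
Qed.

(** The factor [2 * 16 ^+ m] is exactly the quotient of the bound [2 * sg s ^+ 2] left by one
    elimination and the bound [sg s.+1 ^+ 2] required for the next. *)
Let wt_drop s x y : (scale_base m * 4 ^ s <= d x y)%N ->
  wt s.+1 x y * (2 * 16 ^+ m) <= wt s x y.
Proof.
move=> dxy; have e16 : 2 * 16 ^+ m <= expR (2 * 16 ^+ m : R).
  by apply: le_trans (expR_ge1Dx _); rewrite lerDr.
apply: (@le_trans _ _ (wt s.+1 x y * expR (2 * 16 ^+ m))); first by rewrite ler_wpM2l // expR_ge0.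
rewrite /wt -expRD ler_expR -lerBrDl -mulrBl.
have -> : rate s - rate s.+1 = rho * 2^-1 ^+ s / 4 by rewrite /rate exprS; field.
apply: (@le_trans _ _ (rho * 2^-1 ^+ s / 4 * (8 * 16 ^ m * 4 ^ s)%:R)); last first.
  rewrite ler_wpM2l ?ler_nat // mulr_ge0 ?invr_ge0 // mulr_ge0 ?(ltW (half_gt0 s)) //.
  by apply: le_trans rho_ge1.
rewrite !natrM !natrX.
have -> : rho * 2^-1 ^+ s / 4 * (8 * 16 ^+ m * 4 ^+ s) = 2 * 16 ^+ m * (rho * (2^-1 ^+ s * 4 ^+ s)) :> R by field.
apply: ler_peMr; first by rewrite mulr_ge0 ?exprn_ge0.
rewrite -exprMn (_ : 2^-1 * 4 = 2 :> R); last by field.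
by apply: le_trans rho_ge1 _; rewrite ler_peMr ?(le_trans _ rho_ge1) // exprn_ege1 // ler1n.
Qed.

Let reduced_scale k s : exists (S : {set 'I_n}) Phi M,
  [/\ reduced (wt s) H (lam k) (sg s ^+ 2) (8 * sig * (1 - 2^-1 ^+ s)) S Phi M, k \in S
    & if s is s'.+1 then forall y, y \in S -> `|lam y - lam k| <= 4 * sg s' else True].
Proof.
elim: s => [|s [S [Phi [M [red kS _]]]]].
  exists finset.setT, 1%:M, (H - (lam k)%:M); split; rewrite ?inE //; split.
  - by move=> x y _; rewrite mulmx1.
  - by move=> x y; rewrite inE.
  - move=> y _; rewrite /sg expr0 mulr1; apply: le_trans (H_off y).
    apply: ler_sum => x _; rewrite /wt /rate expr0 !mxE.
    have -> : rho * (1 + 1) / 2 = rho by field.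
    by case: (x == y); rewrite // mulr0n subr0.
  - move=> y _; rewrite expr0 !subrr mulr0 /colnorm big1 // => x _.
    by rewrite mxE normr0 mul0r.
(* The mode errors [4 * sg s] are dominated by a geometric series of total [8 * sig]; this is where
   [sig <= 1 / 80] comes from. *)
have F1 : 8 * sig * (1 - 2^-1 ^+ s) <= 1 / 10.
  apply: (@le_trans _ _ (8 * sig)); last by have := sig_small; lra.
  by rewrite ler_piMr ?gerBl ?(ltW (half_gt0 s)) // mulr_ge0 // ltW.
have s4 : sg s <= 1 / 4 by have := sg_small s; lra.
have [S' [Phi' [M' [red' kS' S'E]]]] :=
  reduced_step PP PH Pdiag (wt_ge1 s) (wt_id s) (@wt_mul s) (sg_gt0 s) s4 F1 kS red.
exists S', Phi', M'; split => //; have [h1 h2 h3 h4] := red'; split => // y yS'.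
- have e : sg s.+1 ^+ 2 = (2 * 16 ^+ m)^-1 * (2 * sg s ^+ 2).
    have -> : sg s.+1 = sg s * (4^-1 ^+ m) by rewrite /sg [in LHS]exprSr mulrA.
    have -> : 16 ^+ m = 4 ^+ m * 4 ^+ m :> R by rewrite -exprMn -natrM.
    by rewrite exprVn; field; rewrite expf_neq0 ?pnatr_eq0.
  rewrite e; apply: (@le_trans _ _ ((2 * 16 ^+ m)^-1 * colnorm (wt s) (offdiag M') y)); last first.
    by rewrite ler_wpM2l ?h3 // invr_ge0 mulr_ge0 // exprn_ge0.
  rewrite /colnorm mulr_sumr; apply: ler_sum => x _; rewrite mulrCA !mxE.
  have [_|xy] := eqVneq x y; first by rewrite normr0 !mul0r.
  have [xS'|xS'] := boolP (x \in S'); last by rewrite h2 // normr0 !mul0r.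
  apply: ler_wpM2l => //; rewrite mulrC ler_pdivlMr; last by rewrite mulr_gt0 // exprn_gt0.
  apply: wt_drop; apply: far xy _; have := S'E _ xS'; have := S'E _ yS'.
  have := ler_distD (lam k) (lam x) (lam y); rewrite [`|lam k - _|]distrC; lra.
- apply: (@le_trans _ _ (colnorm (wt s) (Phi' - 1%:M) y)).
    by apply: ler_sum => x _; rewrite ler_wpM2l.
  apply: le_trans (h4 y yS') _; have := sg_le s; rewrite exprS; have := sig_gt0; nra.
Qed.

(** Finiteness ends the iteration: at a late scale [k] is the only survivor. Its effective diagonal
    entry must vanish, so its column of [Phi] is orthogonal to all other eigenvectors, hence a
    multiple of eigenvector [k] by a factor of modulus at least [8 / 10], and it passes on its
    decay. *)
Lemma eigenvector_decay k : \sum_(x | x != k) `|P k x| * expR (rho / 2 * (d x k)%:R) <= 1 / 5.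
Proof.
pose Dm := (\sum_y d y k)%N.
pose s := Num.bound (4 * sig * Dm%:R ^+ m / c).
have hs : 4 * sg s * Dm%:R ^+ m < c.
  have e : 4 * sig * Dm%:R ^+ m / c < 2 ^+ s.
    apply: (@lt_trans _ _ s%:R).
      apply: archi_boundP; rewrite divr_ge0 ?(ltW c_gt0) // mulr_ge0 ?exprn_ge0 //.
      by rewrite mulr_ge0 // ltW.
    by rewrite -natrX ltr_nat ltn_expl.
  move: e; rewrite ltr_pdivrMr // => e.
  apply: (@le_lt_trans _ _ (4 * (sig * 2^-1 ^+ s) * Dm%:R ^+ m)).
    by rewrite ler_wpM2r ?exprn_ge0 // ler_wpM2l.
  rewrite exprVn; have p2 : 0 < 2 ^+ s :> R by rewrite exprn_gt0.
  rewrite (_ : _ * _ = (4 * sig * Dm%:R ^+ m) / 2 ^+ s); last by rewrite !mulrA mulrAC.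
  by rewrite ltr_pdivrMr // [c * _]mulrC.
have [S [Phi [M [red kS SE]]]] := reduced_scale k s.+1.
have Sk y : y \in S -> y = k.
  move=> yS; apply/eqP; apply: contraT => yk.
  have := separated yk; rewrite leNgt => /negP; case; apply: le_lt_trans hs.
  apply: ler_pM; [exact: normr_ge0|exact: exprn_ge0|exact: SE|].
  by apply: lerXn2r; rewrite ?nnegrE // ler_nat /Dm (bigD1 y) //=; exact: leq_addr.
have [h1 h2 h3 h4] := red.
have Mx x : x != k -> M x k = 0.
  by move=> xk; apply: h2 => //; apply: contraNN xk => /Sk ->.
have Pkk : P k k != 0 by rewrite -normr_gt0; have := Pdiag k; lra.
have F1 : 8 * sig * (1 - 2^-1 ^+ s.+1) <= 1 / 10.
  apply: (@le_trans _ _ (8 * sig)); last by have := sig_small; lra.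
  by rewrite ler_piMr ?gerBl ?(ltW (half_gt0 _)) // mulr_ge0 // ltW.
have pairing i : P i k * M k k = (lam i - lam k) * \sum_x P i x * Phi x k.
  rewrite -(eigenvector_pairing PH) (bigD1 k) //= h1 // big1 ?addr0 // => x xk.
  by rewrite h1 // Mx // mulr0.
have Mkk : M k k = 0.
  by have /eqP := pairing k; rewrite subrr mul0r mulf_eq0 (negbTE Pkk) /= => /eqP.
have ortho i : i != k -> \sum_x P i x * Phi x k = 0.
  move=> ik; have /esym/eqP := pairing i; rewrite Mkk mulr0 mulf_eq0 subr_eq0 => /orP[/eqP e|/eqP//].
  have := separated ik; rewrite e subrr normr0 mul0r => c0; have := c_gt0; lra.
pose c0 := \sum_x P k x * Phi x k.
have PP' : P^T *m P = 1%:M by apply: mulmx1C.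
have PhiE x : Phi x k = P k x * c0.
  have : (P^T *m (P *m Phi)) x k = Phi x k by rewrite mulmxA PP' mul1mx.
  move=> <-; rewrite mxE (bigD1 k) //= !mxE [X in _ + X]big1 ?addr0 // => i ik.
  by rewrite [X in _ * X]mxE ortho // mulr0.
have c08 : 8 / 10 <= `|c0| := mode_pairing PP Pdiag (wt_ge1 s.+1) F1 (h4 k kS).
have : colnorm (wt s.+1) (Phi - 1%:M) k <= 1 / 10 := le_trans (h4 k kS) F1.
rewrite /colnorm (bigD1 k) //= => hc.
have : 8 / 10 * \sum_(x | x != k) `|P k x| * expR (rho / 2 * (d x k)%:R) <= 1 / 10.
  apply: le_trans hc; rewrite mulr_sumr -[leLHS]add0r; apply: lerD.
    by rewrite mulr_ge0 // (le_trans _ (wt_ge1 _ _ _)).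
  apply: ler_sum => x xk; rewrite !mxE (negbTE xk) mulr0n subr0 PhiE normrM mulrA.
  apply: ler_pM; [by rewrite !mulr_ge0 ?invr_ge0|exact: expR_ge0| |].
    by rewrite [_ * `|P k x|]mulrC ler_wpM2l.
  by rewrite ler_expR ler_wpM2r.
lra.
Qed.

End Localization.

(** * Schroedinger operators on a cyclic group *)

Lemma quadratic_formE (R : realFieldType) n (A : 'M[R]_n) (u v : 'rV[R]_n) :
  (u *m A *m v^T) 0 0 = \sum_x \sum_y u 0 x * A x y * v 0 y.
Proof.
rewrite exchange_big mxE; apply: eq_bigr => y _; rewrite mxE mulr_suml.
by apply: eq_bigr => x _; rewrite [v^T _ _]mxE.
Qed.

Lemma quadratic_form_le (R : realFieldType) n (A : 'M[R]_n) (u : 'rV[R]_n) :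
  `|(u *m A *m u^T) 0 0| <= (\sum_x \sum_y `|A x y|) * (u *m u^T) 0 0.
Proof.
rewrite quadratic_formE mulr_suml (le_trans (ler_norm_sum _ _ _)) //.
apply: ler_sum => x _; rewrite mulr_suml (le_trans (ler_norm_sum _ _ _)) //.
apply: ler_sum => y _; rewrite mulrAC mulrC normrM; apply: ler_wpM2l => //.
have hu z : u 0 z ^+ 2 <= (u *m u^T) 0 0.
  rewrite mxE (bigD1 z) //= mxE expr2 lerDl sumr_ge0 // => i _.
  by rewrite mxE -expr2 sqr_ge0.
have := hu x; have := hu y; rewrite ler_norml; nra.
Qed.

Definition schrodinger (R : realFieldType) n (V : 'I_n -> R) (Delta : 'M[R]_n) (e : R) : 'M[R]_n :=
  diag_mx (\row_x V x) + e *: Delta.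

Section Cyclic.
Variables (R : realType) (n : nat) (Delta : 'M[R]_n.+1) (V : 'I_n.+1 -> R) (g : R).
Hypothesis Delta_sym : Delta^T = Delta.
Hypothesis Delta_inv : forall a x y, Delta (x + a) (y + a) = Delta x y.
Hypothesis g_gt0 : 0 < g.
Hypothesis V_gap : forall i j : 'I_n.+1, (i <= j)%N -> g * (j%:R - i%:R) <= V j - V i.

Local Notation Ham := (schrodinger V Delta).

(** A crude norm bound that depends on the size of the group; it affects only the number of
    continuation steps. *)
Let K := \sum_x \sum_y `|Delta x y|.

Lemma schrodinger_sym e : (Ham e)^T = Ham e.
Proof. by rewrite /schrodinger linearD /= tr_diag_mx linearZ /= Delta_sym. Qed.

Lemma schrodinger_quad e (u : 'rV[R]_n.+1) :
  (u *m Ham e *m u^T) 0 0 = \sum_x V x * u 0 x ^+ 2 + e * (u *m Delta *m u^T) 0 0.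
Proof.
rewrite /schrodinger mulmxDr mulmxDl mxE -scalemxAr -scalemxAl [X in _ + X]mxE; congr (_ + _).
rewrite mul_mx_diag mxE; apply: eq_bigr => x _; rewrite !mxE; ring.
Qed.

(* Translating by [a] raises the potential by [g * a] at every site except the [a] lowest ones. *)
Lemma cyclic_gap e P lam (i j : 'I_n.+1) : eigensystem (Ham e) P lam -> (i <= j)%N ->
  g * (j%:R - i%:R) <= lam j - lam i.
Proof.
move=> es ij; pose a : 'I_n.+1 := inord (j - i).
have va : a = (j - i)%N :> nat by rewrite inordK // ltnS; have := ltn_ord j; lia.
pose S : 'M[R]_n.+1 := \matrix_(x, y) (x == y + a)%:R.
pose F : 'M[R]_(n.+1, j - i) := \matrix_(x, l) (x == l :> nat)%:R.
rewrite lerBrDl -natrB // -va.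
apply: (@eigenvalue_comparison _ _ (j - i) (Ham e) (Ham e) S F P lam P lam _ j i) => //; last by rewrite subnKC.
move=> u uF.
have u0 (x : 'I_n.+1) : (x < j - i)%N -> u 0 x = 0.
  move=> xl; have /rowP/(_ (Ordinal xl)) := uF; rewrite [RHS]mxE => <-.
  rewrite mxE (bigD1 x) //= mxE eqxx mulr1 big1 ?addr0 // => y yx.
  by rewrite mxE /= (inj_eq val_inj) (negbTE yx) mulr0.
have uS y : (u *m S) 0 y = u 0 (y + a).
  rewrite mxE (bigD1 (y + a)) //= mxE eqxx mulr1 big1 ?addr0 // => x xy.
  by rewrite mxE (negbTE xy) mulr0.
have nS : (u *m S *m (u *m S)^T) 0 0 = (u *m u^T) 0 0.
  rewrite [RHS]mxE (reindex_inj (addIr a)) [LHS]mxE /=; apply: eq_bigr => y _.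
  by rewrite [(u *m S)^T _ _]mxE [u^T _ _]mxE uS.
split=> //.
have DS : (u *m S *m Delta *m (u *m S)^T) 0 0 = (u *m Delta *m u^T) 0 0.
  rewrite !quadratic_formE [RHS](reindex_inj (addIr a)); apply: eq_bigr => x _.
  rewrite [RHS](reindex_inj (addIr a)); apply: eq_bigr => y _.
  by rewrite !uS Delta_inv.
rewrite !schrodinger_quad DS addrAC lerD2r.
have -> : (u *m u^T) 0 0 = \sum_x u 0 x ^+ 2.
  by rewrite mxE; apply: eq_bigr => x _; rewrite mxE expr2.
rewrite [leRHS](reindex_inj (addIr a)) [X in _ + _ * X](reindex_inj (addIr a)) mulr_sumr -big_split /=.
apply: ler_sum => y _; rewrite uS -mulrDl.
(* The sum [y + a] wraps around the group exactly when its representative falls below [a], and there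
   the constraint makes [u] vanish. Elsewhere it is the ordinary sum and the potential gap
   applies. *)
have [ya|ya] := ltnP (y + a)%R (j - i); first by rewrite u0 // expr0n /= !mulr0.
apply: ler_wpM2r; first exact: sqr_ge0.
have e1 : nat_of_ord (y + a)%R = (y + a)%N.
  move: ya; rewrite -va /= => ya; rewrite modn_small //; rewrite ltnNge; apply/negP => h.
  move: ya; rewrite -(subnK h) modnDr modn_small; have := ltn_ord y; have := ltn_ord a; lia.
have := V_gap (i := y) (j := y + a); rewrite e1 leq_addr natrD => /(_ isT).
by rewrite lerBrDl addrAC subrr add0r.
Qed.

Lemma weyl e e' P P' lam lam' k : eigensystem (Ham e) P lam -> eigensystem (Ham e') P' lam' ->
  lam k - `|e' - e| * K <= lam' k.
Proof.
move=> es es'.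
apply: (@eigenvalue_comparison _ _ 0 (Ham e') (Ham e) 1%:M 0 P' lam' P lam _ k k) => //; last by rewrite addn0.
move=> u _; rewrite mulmx1; split=> //; rewrite !schrodinger_quad -addrA lerD2l.
have := quadratic_form_le Delta u; set x := (u *m Delta *m u^T) 0 0; set y := (u *m u^T) 0 0 => h.
have : `|(e' - e) * x| <= `|e' - e| * (K * y) by rewrite normrM ler_wpM2l.
by rewrite ler_norml => /andP[h1 _]; lra.
Qed.

(** For [i != k], the overlap of the old eigenvector [k] with the new eigenvector [i], times
    [lam' i - lam k], is a matrix element of the perturbation. That difference is at least [g / 2]:
    the new levels are [g] apart and by Weyl's inequality level [k] moves by at most [g / 2]. So the
    eigenvector with a given rank hardly rotates. *)
Lemma continuation_step e e' P P' lam lam' k : eigensystem (Ham e) P lam -> eigensystem (Ham e') P' lam' ->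
  `|e' - e| * K <= g / 2 ->
  `|P k k| - n.+1%:R * (`|e' - e| * K / (g / 2)) <= `|P' k k|.
Proof.
move=> es es' small; set b := `|e' - e| * K in small *.
have [PP PH _] := es; have [PP' PH' _] := es'.
pose a := P *m P'^T.
have aa : a *m a^T = 1%:M.
  by rewrite /a trmx_mul trmxK mulmxA -[P *m _ *m _]mulmxA (mulmx1C PP') mulmx1.
have b0 : 0 <= b by rewrite mulr_ge0 // sumr_ge0 // => x _; rewrite sumr_ge0.
have g2 : 0 < g / 2 by rewrite divr_gt0.
have am (i : 'I_n.+1) : i != k -> `|a k i| <= b / (g / 2).
  move=> ik; rewrite ler_pdivlMr // mulrC.
  have e1 : (lam' i - lam k) * a k i = (e' - e) * (row k P *m Delta *m (row i P')^T) 0 0.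
    have aE : a k i = (row k P *m (row i P')^T) 0 0.
      by rewrite !mxE; apply: eq_bigr => x _; rewrite !mxE.
    have h1 : row k P *m Ham e' *m (row i P')^T = lam' i *: (row k P *m (row i P')^T).
      rewrite -mulmxA -[Ham e']schrodinger_sym -trmx_mul PH' linearZ /= -scalemxAr.
      by [].
    have h2 : row k P *m Ham e *m (row i P')^T = lam k *: (row k P *m (row i P')^T).
      by rewrite PH -scalemxAl.
    have : row k P *m (Ham e' - Ham e) *m (row i P')^T = (lam' i - lam k) *: (row k P *m (row i P')^T).
      by rewrite mulmxBr mulmxBl h1 h2 scalerBl.
    have -> : Ham e' - Ham e = (e' - e) *: Delta.
      by rewrite /schrodinger opprD addrACA subrr add0r scalerBl.
    rewrite -scalemxAr -scalemxAl => /matrixP/(_ 0 0); rewrite aE [LHS]mxE [RHS]mxE.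
    by move=> ->.
  have e2 : `|(row k P *m Delta *m (row i P')^T) 0 0| <= K.
    rewrite quadratic_formE (le_trans (ler_norm_sum _ _ _)) //; apply: ler_sum => x _.
    rewrite (le_trans (ler_norm_sum _ _ _)) //; apply: ler_sum => y _.
    rewrite !normrM mulrAC mulrC ler_piMr // !mxE.
    by rewrite -[leRHS]mulr1; apply: ler_pM => //; exact: orthogonal_entry_le1.
  have e3 : g <= `|lam' i - lam' k|.
    have gl (i1 i2 : 'I_n.+1) : (i1 < i2)%N -> g <= lam' i2 - lam' i1.
      move=> h; apply: le_trans (cyclic_gap es' (ltnW h)); rewrite ler_peMr ?(ltW g_gt0) //.
      by rewrite -natrB ?ler1n ?subn_gt0 // ltnW.
    move: ik; rewrite -val_eqE neq_ltn => /orP[/gl|/gl] h; last by rewrite (le_trans h) // ler_norm.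
    by rewrite distrC (le_trans h) // ler_norm.
  have w1 := weyl k es es'; have w2 := weyl k es' es; rewrite [`|e - e'|]distrC -/b in w1 w2.
  have e4 : `|lam' k - lam k| <= b by rewrite ler_norml; apply/andP; split; lra.
  have e5 : g / 2 <= `|lam' i - lam k|.
    have := ler_distD (lam k) (lam' i) (lam' k); rewrite [`|lam k - _|]distrC; lra.
  apply: (@le_trans _ _ (`|lam' i - lam k| * `|a k i|)); first exact: ler_wpM2r.
  by rewrite -normrM e1 normrM /b ler_wpM2l.
have -> : P k k = \sum_i a k i * P' i k.
  by rewrite -[P in LHS]mulmx1 -(mulmx1C PP') mulmxA mxE.
rewrite lerBlDr (le_trans (ler_norm_sum _ _ _)) // (bigD1 k) //=; apply: lerD.
  by rewrite normrM ler_piMl // orthogonal_entry_le1.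
apply: (@le_trans _ _ (\sum_(i | i != k) b / (g / 2))).
  apply: ler_sum => i ik; rewrite normrM -[leRHS]mulr1; apply: ler_pM => //; first exact: am.
  exact: orthogonal_entry_le1.
rewrite sumr_const -[leLHS]mulr_natl; apply: ler_wpM2r; first by rewrite divr_ge0 // ltW.
by rewrite ler_nat (leq_trans (max_card _)) // card_ord.
Qed.

Variables (d : 'I_n.+1 -> 'I_n.+1 -> nat) (m : nat) (c sig rho eps : R).
Hypothesis d_id : forall x, d x x = 0%N.
Hypothesis d_triangle : forall x y z, (d x z <= d x y + d y z)%N.
Hypothesis m_gt0 : (0 < m)%N.
Hypothesis c_gt0 : 0 < c.
Hypothesis separated : forall x y : 'I_n.+1, x != y -> c <= g * `|x%:R - y%:R| * (d x y)%:R ^+ m.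
Hypothesis sig_gt0 : 0 < sig.
Hypothesis sig_small : sig <= 1 / 80.
Hypothesis sig_base : 8 * sig * (scale_base m)%:R ^+ m <= c.
Hypothesis rho_ge1 : 1 <= rho.
Hypothesis eps_ge0 : 0 <= eps.
Hypothesis eps_small :
  forall y, eps * colnorm (fun x y => expR (rho * (d x y)%:R)) Delta y <= sig ^+ 2.

Lemma cyclic_decay e P lam k : 0 <= e -> e <= eps -> eigensystem (Ham e) P lam ->
  (forall i, 9 / 10 <= `|P i i|) ->
  \sum_(x | x != k) `|P k x| * expR (rho / 2 * (d x k)%:R) <= 1 / 5.
Proof.
move=> e0 ee es Pd; have [PP PH _] := es.
apply: (eigenvector_decay PP PH Pd d_id d_triangle m_gt0 c_gt0 _ sig_gt0 sig_small sig_base rho_ge1).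
  move=> x y xy; apply: le_trans (separated xy) _; apply: ler_wpM2r; first exact: exprn_ge0.
  have [h|h] := leqP x y.
    rewrite distrC [leRHS]distrC ger0_norm ?subr_ge0 ?ler_nat //.
    by apply: le_trans (cyclic_gap es h) _; exact: ler_norm.
  rewrite ger0_norm ?subr_ge0 ?ler_nat ?(ltnW h) //.
  by apply: le_trans (cyclic_gap es (ltnW h)) _; exact: ler_norm.
move=> y; apply: le_trans (eps_small y); rewrite /colnorm mulr_sumr; apply: ler_sum => x _.
rewrite mulrA; apply: ler_wpM2r; first exact: expR_ge0.
rewrite !mxE; case: eqP => _; first by rewrite normr0 mulr_ge0.
by rewrite mulr0n add0r normrM ger0_norm // ler_wpM2r.
Qed.

Theorem cyclic_localization : exists (P : 'M[R]_n.+1) lam,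
  [/\ forall k, row k P *m Ham eps = lam k *: row k P,
      forall i j : 'I_n.+1, (i <= j)%N -> g * (j%:R - i%:R) <= lam j - lam i,
      forall k, 9 / 10 <= `|P k k|
    & forall k, \sum_(x | x != k) `|P k x| * expR (rho / 2 * (d x k)%:R) <= 1 / 5].
Proof.
have K0 : 0 <= K by rewrite sumr_ge0 // => x _; rewrite sumr_ge0.
pose N := (Num.bound (20 * n.+1%:R * (eps * K / (g / 2)))).+1.
have N0 : 0 < N%:R :> R by rewrite ltr0n.
have g2 : 0 < g / 2 by rewrite divr_gt0.
have epK : 0 <= eps * K by rewrite mulr_ge0.
have Nlarge : n.+1%:R * (eps / N%:R * K / (g / 2)) <= 1 / 20.
  have : 20 * n.+1%:R * (eps * K / (g / 2)) < N%:R.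
    apply: (@lt_le_trans _ _ (Num.bound (20 * n.+1%:R * (eps * K / (g / 2))))%:R).
      by apply: archi_boundP; rewrite mulr_ge0 ?mulr_ge0 // invr_ge0 ltW.
    by rewrite ler_nat.
  have -> : eps / N%:R * K / (g / 2) = (eps * K / (g / 2)) / N%:R by field; rewrite !gt_eqF.
  by rewrite [leLHS]mulrA => h; rewrite ler_pdivrMr //; lra.
have small : eps / N%:R * K <= g / 2.
  have h : eps / N%:R * K / (g / 2) <= 1.
    apply: (@le_trans _ _ (1 / 20)); last by lra.
    apply: le_trans Nlarge; rewrite ler_peMl ?ler1n //.
    by rewrite divr_ge0 ?(ltW g2) // mulr_ge0 // divr_ge0 // ltW.
  by move: h; rewrite ler_pdivrMr // mul1r.
(* [N] is such that one increment of the coupling lowers a diagonal entry by at most [1 / 20], from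
   [95 / 100] to the [9 / 10] under which the decay estimate applies. *)
have step i : (i <= N)%N -> exists P lam, eigensystem (Ham (eps * (i%:R / N%:R))) P lam /\
    forall k, 95 / 100 <= `|P k k|.
  elim: i => [|i IH] iN.
    exists 1%:M, V; split; last by move=> k; rewrite mxE eqxx normr1; lra.
    split; first by rewrite trmx1 mulmx1.
      by move=> k; rewrite mul0r mulr0 /schrodinger scale0r addr0 row1 -rowE row_diag_mx mxE.
    move=> i j ij; rewrite -subr_ge0; apply: le_trans (V_gap ij).
    by rewrite mulr_ge0 ?(ltW g_gt0) // subr_ge0 ler_nat.
  have [P [lam [es Pd]]] := IH (ltnW iN).
  have [P' [lam' es']] := symmetric_eigensystem (schrodinger_sym (eps * (i.+1%:R / N%:R))).
  have de : `|eps * (i.+1%:R / N%:R) - eps * (i%:R / N%:R)| = eps / N%:R.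
    by rewrite -mulrBr -mulrBl -natrB // subSnn mul1r ger0_norm // divr_ge0 // ltW.
  have Pd' k : 9 / 10 <= `|P' k k|.
    have := continuation_step k es es'; rewrite de => /(_ small).
    have := Pd k; have := Nlarge; lra.
  exists P', lam'; split=> // k; have [PP' _ _] := es'.
  have e0 : 0 <= eps * (i.+1%:R / N%:R) by rewrite mulr_ge0 // divr_ge0 // ltW.
  have e1 : eps * (i.+1%:R / N%:R) <= eps by rewrite ler_piMr // ler_pdivrMr // mul1r ler_nat.
  have hs : \sum_(x | x != k) `|P' k x| <= 1 / 5.
    apply: le_trans (cyclic_decay k e0 e1 es' Pd'); apply: ler_sum => x _.
    rewrite ler_peMr // -[leLHS](@expR0 R) ler_expR mulr_ge0 //; have := rho_ge1; lra.
  have h1 : \sum_x P' k x ^+ 2 = 1.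
    have /matrixP/(_ k k) := PP'; rewrite !mxE eqxx mulr1n => <-.
    by apply: eq_bigr => z _; rewrite mxE expr2.
  (* An off-diagonal [l^1] mass of [1 / 5] leaves at least [24 / 25] for the square of the diagonal
     entry, which restores [95 / 100]. *)
  have h2 : \sum_(x | x != k) P' k x ^+ 2 <= 1 / 5 * (1 / 5).
    apply: (@le_trans _ _ (1 / 5 * \sum_(x | x != k) `|P' k x|)); last by rewrite ler_wpM2l ?divr_ge0.
    rewrite mulr_sumr; apply: ler_sum => x xk; rewrite -real_normK ?num_real // expr2.
    apply: ler_wpM2r => //; apply: le_trans hs; rewrite (bigD1 x) //= lerDl sumr_ge0 //.
  move: h1; rewrite (bigD1 k) //= -real_normK ?num_real //.
  by have := normr_ge0 (P' k k); nra.
have [P [lam [es Pd]]] := step N (leqnn N).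
have e1 : eps * (N%:R / N%:R) = eps by rewrite divff ?mulr1 // gt_eqF.
rewrite e1 in es; have [_ PH _] := es.
have Pd' k : 9 / 10 <= `|P k k| by have := Pd k; lra.
exists P, lam; split => //; first by move=> i j; exact: cyclic_gap es.
by move=> k; apply: (cyclic_decay k eps_ge0 (lexx eps) es).
Qed.

End Cyclic.

(** * Rational approximation of the frequencies *)

Section Norm1.
Variable d : nat.
Implicit Types x y : Zd d.

Lemma norm1_0 : norm1 (0 : Zd d) = 0%N.
Proof. by rewrite /norm1 big1 // => i _; rewrite mxE. Qed.

Lemma norm1_eq0 x : (norm1 x == 0%N) = (x == 0).
Proof.
apply/eqP/eqP => [|->]; last exact: norm1_0.
move=> /eqP; rewrite /norm1 sum_nat_eq0 => /forallP h; apply/rowP => i; rewrite mxE.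
by apply/eqP; rewrite -absz_eq0; exact: h.
Qed.

Lemma norm1N x : norm1 (- x) = norm1 x.
Proof. by apply: eq_bigr => i _; rewrite mxE abszN. Qed.

Lemma norm1D x y : (norm1 (x + y) <= norm1 x + norm1 y)%N.
Proof.
rewrite /norm1 -big_split; apply: leq_sum => i _ /=; by rewrite mxE -lez_nat PoszD !abszE ler_normD.
Qed.

Lemma norm1_unitv (i : 'I_d) : norm1 (unitv i) = 1%N.
Proof.
rewrite /norm1 (bigD1 i) //= big1 ?addn0; first by rewrite mxE !eqxx.
by move=> j /negbTE ji; rewrite mxE eqxx ji.
Qed.

End Norm1.

Lemma powR_natX_ge (R : realType) (a tau : R) m : 1 <= a -> tau + 1 <= m%:R ->
  a <= powR a (- tau) * a ^+ m.
Proof.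
move=> a1 tm; have a0 : 0 <= a by lra.
rewrite -powR_mulrn // -powRD; last by rewrite implybE; apply/orP; right; rewrite gt_eqF //; lra.
rewrite -[leLHS]powRr1 //; apply: ler_powR => //; lra.
Qed.

Definition residue n (k : int) : 'I_n.+1 := inZp `|(k %% n.+1)%Z|.

Section Residue.
Variable n : nat.

Lemma residueE k : (residue n k : nat)%:Z = (k %% n.+1)%Z.
Proof.
have h0 : (0 <= k %% n.+1)%Z by rewrite modz_ge0.
have h1 : (k %% n.+1 < n.+1)%Z by rewrite ltz_pmod.
rewrite /= modn_small ?gez0_abs //; lia.
Qed.

Lemma residue_inj a b : residue n a = residue n b <-> (a = b %[mod n.+1])%Z.
Proof.
split=> [/(congr1 (fun i : 'I_n.+1 => (i : nat)%:Z))|h]; first by rewrite !residueE.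
by apply: val_inj; apply/eqP; rewrite -eqz_nat !residueE h.
Qed.

Lemma residueD a b : residue n (a + b) = residue n a + residue n b.
Proof.
apply: val_inj; apply/eqP; rewrite -eqz_nat residueE /= -modz_nat PoszD.
by rewrite !residueE modzDm.
Qed.

Lemma residue0 : residue n 0 = 0.
Proof. by apply: val_inj; apply/eqP; rewrite -eqz_nat residueE mod0z. Qed.

Lemma residueN a : residue n (- a) = - residue n a.
Proof. by apply/eqP; rewrite -addr_eq0 -residueD addNr residue0. Qed.

Lemma residue_nat (j : 'I_n.+1) : residue n (j : nat) = j.
Proof. by apply: val_inj; apply/eqP; rewrite -eqz_nat residueE modz_small //= ltz_nat ltn_ord. Qed.

Lemma residue_mod k : exists l : int, (residue n k : nat)%:Z = k + l * n.+1%:Z.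
Proof.
exists (- (k %/ n.+1)%Z); rewrite residueE {2}(divz_eq k n.+1); ring.
Qed.

End Residue.

Lemma UBLM_periodic (R : realType) (L : R) (v : R -> R) (t : R) (k : int) :
  UBLM L v -> t \notin range (fun k : int => k%:~R) -> v (t + k%:~R) = v t.
Proof.
move=> [per _]; have step u : u \notin range (fun k : int => k%:~R : R) -> forall m : nat, v (u + m%:R) = v u.
  move=> hu; elim=> [|m IH]; first by rewrite addr0.
  rewrite -natr1 addrA per //; apply: contraNN hu; rewrite !inE => -[l _ e].
  by exists (l - m%:Z) => //; rewrite rmorphB /= e addrK.
move=> ht; case: k => m; first exact: step.
rewrite NegzE rmorphN /=; set s := _%:~R.
rewrite -(step (t - s) _ m.+1) ?subrK //; apply: contraNN ht; rewrite !inE => -[l _ e].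
by exists (l + m.+1%:Z) => //; rewrite rmorphD /= e subrK.
Qed.

Lemma open_unit_notin (R : realType) (t : R) : 0 < t -> t < 1 ->
  t \notin range (fun k : int => k%:~R : R).
Proof.
move=> t0 t1; apply/negP; rewrite inE => -[l _ e]; move: t0 t1; rewrite -e.
by rewrite ltr0z -[1]/(1%:~R) ltr_int; lia.
Qed.

Section Approximant.
Variables (R : realType) (d : nat) (tau gamma L : R) (w : 'I_d -> R) (v : R -> R).
Hypothesis w_DC : DC tau gamma w.
Hypothesis v_UBLM : UBLM L v.
Hypothesis gamma_gt0 : 0 < gamma.
Hypothesis L_gt0 : 0 < L.
Variable n : nat.
Local Notation q := n.+1.

Definition approx_freq (i : 'I_d) : int := Num.floor (q%:R * w i).
Definition dotp (x : Zd d) : int := \sum_(i < d) x ord0 i * approx_freq i.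

Lemma dotpD x y : dotp (x + y) = dotp x + dotp y.
Proof. by rewrite /dotp -big_split; apply: eq_bigr => i _; rewrite mxE mulrDl. Qed.

Lemma dotpN x : dotp (- x) = - dotp x.
Proof. by rewrite /dotp -sumrN; apply: eq_bigr => i _; rewrite mxE mulNr. Qed.

Lemma dotp_approx x : `|(dotp x)%:~R / q%:R - dotw x w| <= (norm1 x)%:R / q%:R.
Proof.
have q0 : 0 < q%:R :> R by rewrite ltr0n.
rewrite /dotp /dotw /norm1 rmorph_sum mulr_suml -sumrB (le_trans (ler_norm_sum _ _ _)) //.
rewrite natr_sum mulr_suml; apply: ler_sum => i _; rewrite rmorphM /=.
have -> : (x ord0 i)%:~R * (approx_freq i)%:~R / q%:R - (x ord0 i)%:~R * w i =
   (x ord0 i)%:~R * ((approx_freq i)%:~R - q%:R * w i) / q%:R.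
  by field; rewrite gt_eqF.
rewrite !normrM normfV [`|q%:R|]ger0_norm //; apply: ler_wpM2r; first by rewrite invr_ge0 ltW.
have -> : (`|x ord0 i|%N)%:R = `|(x ord0 i)%:~R| :> R by rewrite -intr_norm natr_absz.
rewrite ler_piMr // distrC ger0_norm ?subr_ge0 ?floor_le //.
by rewrite lerBlDr addrC ltW // (lt_le_trans (floorD1_gt _)) // rmorphD.
Qed.

(** Rounding the frequencies moves the phase by at most [norm1 x / q]; as long as this is below half
    of the Diophantine bound, the other half survives. *)
Lemma approx_DC x l : x != 0 -> (norm1 x)%:R / q%:R <= gamma / 2 * powR (norm1 x)%:R (- tau) ->
  gamma / 2 * powR (norm1 x)%:R (- tau) <= `|l%:~R - (dotp x)%:~R / q%:R|.
Proof.
move=> x0 h; have [_ /(_ x x0 l) h1] := w_DC; have h2 := dotp_approx x.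
have := ler_distD ((dotp x)%:~R / q%:R) (l%:~R : R) (dotw x w).
move: h h1 h2; set p := powR _ _; set a := `|_ - dotw x w|; set b := `|_ - dotw x w|; set c := `|_ - _ / _|.
set e := _ / _ => h h1 h2 h3.
have : gamma * p = gamma / 2 * p + gamma / 2 * p by field.
move: (gamma * p) (gamma / 2 * p) h h1 => u u2; lra.
Qed.

Definition reachable (j : 'I_q) (k : nat) : bool :=
  (k == q) || `[< exists2 z : Zd d, (norm1 z <= k)%N & residue n (dotp z) = j >].

Lemma reachable_ex j : exists k, reachable j k.
Proof. by exists q; rewrite /reachable eqxx. Qed.

(* Word length in the cyclic group, capped at its order (the frequencies need not generate it). *)
Definition len (j : 'I_q) : nat := ex_minn (reachable_ex j).

Lemma len_le j k : reachable j k -> (len j <= k)%N.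
Proof. by rewrite /len; case: ex_minnP => m _ h /h. Qed.

Lemma lenP j : len j = q \/ exists2 z : Zd d, (norm1 z <= len j)%N & residue n (dotp z) = j.
Proof. by rewrite /len; case: ex_minnP => m /orP[/eqP|/asboolP] h _; [left|right]. Qed.

Lemma len_norm1 z : (len (residue n (dotp z)) <= norm1 z)%N.
Proof. by apply: len_le; apply/orP; right; apply/asboolP; exists z. Qed.

Lemma len_leq j : (len j <= q)%N.
Proof. by apply: len_le; rewrite /reachable eqxx. Qed.

Lemma dotp0 : dotp 0 = 0.
Proof. by rewrite /dotp big1 // => i _; rewrite mxE mul0r. Qed.

Lemma len0 : len 0 = 0%N.
Proof. by apply/eqP; rewrite -leqn0 -(norm1_0 d) -(residue0 n) -dotp0 len_norm1. Qed.

Lemma lenD (i j : 'I_q) : (len (i + j)%R <= len i + len j)%N.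
Proof.
have [e|[x xi rx]] := lenP i; first by rewrite e (leq_trans (len_leq _)) // leq_addr.
have [e|[y yj ry]] := lenP j; first by rewrite e (leq_trans (len_leq _)) // leq_addl.
rewrite -{1}rx -{1}ry -residueD -dotpD (leq_trans (len_norm1 _)) // (leq_trans (norm1D _ _)) //.
exact: leq_add.
Qed.

Definition cdist (x y : 'I_q) : nat := len (x - y).

Lemma cdist_id x : cdist x x = 0%N.
Proof. by rewrite /cdist subrr len0. Qed.

Lemma cdist_triangle x y z : (cdist x z <= cdist x y + cdist y z)%N.
Proof. by rewrite /cdist -(subrKA y) lenD. Qed.

Lemma residue_diff (x y : 'I_q) z : residue n z = x - y ->
  exists l : int, `|x%:R - y%:R| / q%:R = `|l%:~R - z%:~R / q%:R| :> R.
Proof.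
move=> e; have e1 : residue n ((x : nat)%:Z - (y : nat)%:Z) = residue n z.
  by rewrite residueD residueN !residue_nat e.
have [l1 h1] := residue_mod n z; have [l2 h2] := residue_mod n ((x : nat)%:Z - (y : nat)%:Z).
have q0 : q%:R != 0 :> R by rewrite pnatr_eq0.
rewrite e1 h1 in h2; exists (l2 - l1).
have h3 : z%:~R + l1%:~R * q%:R = x%:R - y%:R + l2%:~R * q%:R :> R.
  by have /(congr1 (fun k : int => k%:~R : R)) := h2; rewrite !rmorphD !rmorphM rmorphN.
rewrite -[q%:R in LHS]ger0_norm // -normf_div distrC; congr `|_|.
have -> : (z%:~R : R) = x%:R - y%:R + l2%:~R * q%:R - l1%:~R * q%:R by rewrite -h3 addrK.
by rewrite rmorphB /=; field.
Qed.

(** Three regimes. If the length is capped at [q], the spacing [1 / q] times [q ^+ m] is at least 1.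
    For a short word the rounded Diophantine bound holds. For a long one the spacing [1 / q]
    suffices, since the failing comparison says that [norm1 z] to the power [tau + 1] exceeds
    [q * gamma / 2]; hence the exponent [m >= tau + 1]. *)
Lemma cyclic_separated m (x y : 'I_q) : tau + 1 <= m%:R -> (0 < m)%N -> x != y ->
  L * Num.min 1 (gamma / 2) <= L / q%:R * `|x%:R - y%:R| * (cdist x y)%:R ^+ m.
Proof.
move=> tm m0 xy; have q0 : 0 < q%:R :> R by rewrite ltr0n.
rewrite -!mulrA; apply: ler_wpM2l; first exact: ltW.
rewrite mulrA [_^-1 * _]mulrC.
have xy1 : 1 <= `|x%:R - y%:R| :> R.
  wlog : x y xy / (x < y)%N.
    move=> h; move: (xy); rewrite -val_eqE neq_ltn => /orP[/h|/h]; first by apply.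
    by rewrite eq_sym distrC; apply.
  by move=> h; rewrite distrC ger0_norm ?subr_ge0 ?ler_nat ?(ltnW h) // -natrB ?(ltnW h) // ler1n subn_gt0.
have [e|[z zl rz]] := lenP (x - y).
  rewrite /cdist e ge_min; apply/orP; left.
  apply: (@le_trans _ _ (1 / q%:R * q%:R ^+ m)); last first.
    by apply: ler_wpM2r; [exact: exprn_ge0|rewrite ler_pM2r ?invr_gt0].
  by case: m m0 {tm} => // m' _; rewrite exprS mul1r mulKf ?gt_eqF // exprn_ege1 // ler1n.
have z0 : z != 0.
  by apply: contraNneq xy => z0; rewrite -subr_eq0 -rz z0 dotp0 residue0.
have nz : 1 <= (norm1 z)%:R :> R by rewrite ler1n lt0n norm1_eq0.
apply: (@le_trans _ _ (`|x%:R - y%:R| / q%:R * (norm1 z)%:R ^+ m)); last first.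
  apply: ler_wpM2l; first by rewrite divr_ge0 // ltW.
  by apply: lerXn2r; rewrite ?nnegrE // ler_nat.
have hp := powR_natX_ge nz tm; have g2 : 0 < gamma / 2 by rewrite divr_gt0.
have hp0 : 0 <= (norm1 z)%:R ^+ m :> R by exact: exprn_ge0.
have [h|h] := lerP ((norm1 z)%:R / q%:R) (gamma / 2 * powR (norm1 z)%:R (- tau)).
  have [l ->] := residue_diff rz.
  rewrite ge_min; apply/orP; right.
  apply: (@le_trans _ _ (gamma / 2 * powR (norm1 z)%:R (- tau) * (norm1 z)%:R ^+ m)).
    rewrite -mulrA ler_peMr ?(ltW g2) //; exact: le_trans hp.
  by apply: ler_wpM2r => //; exact: approx_DC.
rewrite ge_min; apply/orP; right.
apply: (@le_trans _ _ (1 / q%:R * (norm1 z)%:R ^+ m)); last first.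
  by apply: ler_wpM2r => //; rewrite ler_pM2r ?invr_gt0.
rewrite mul1r -(@ler_pM2l _ (norm1 z)%:R); last by lra.
apply: (@le_trans _ _ (gamma / 2 * powR (norm1 z)%:R (- tau) * (norm1 z)%:R ^+ m)).
  rewrite -[leRHS]mulrA [leLHS]mulrC; apply: ler_wpM2l => //; exact: ltW.
rewrite [leRHS]mulrA; apply: ler_wpM2r => //; exact: ltW.
Qed.

End Approximant.

(** * Transfer of modes from the cyclic group to the lattice *)

Section LatticeApproximant.
Variables (R : realType) (d : nat) (tau gamma L : R) (w : 'I_d -> R) (v : R -> R).
Hypothesis w_DC : DC tau gamma w.
Hypothesis v_UBLM : UBLM L v.
Hypothesis tau_gt0 : 0 < tau.
Hypothesis gamma_gt0 : 0 < gamma.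
Hypothesis L_gt0 : 0 < L.
Variable n : nat.
Local Notation q := n.+1.
Local Notation dotp := (dotp w n).
Local Notation len := (@len R d w n).

Let q_gt0 : 0 < q%:R :> R.
Proof. by rewrite ltr0n. Qed.

(** The shift by [1 / 2] keeps every sample inside the open unit interval, where [v] is monotone,
    even at [j = 0]. *)
Definition cyclic_potential (j : 'I_q) : R := v ((j%:R + 1 / 2) / q%:R).

(** Neighbours that coincide in the group are counted with multiplicity, so a function pulled back
    to the lattice satisfies the lattice equation exactly. *)
Definition cyclic_laplacian : 'M[R]_q :=
  \matrix_(x, y) \sum_(i < d) ((x == y + residue n (dotp (unitv i)))%:R +
                               (x == y - residue n (dotp (unitv i)))%:R).

Let phase_itv (j : 'I_q) : 0 < (j%:R + 1 / 2) / q%:R :> R /\ (j%:R + 1 / 2) / q%:R < 1 :> R.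
Proof.
split; first by rewrite divr_gt0 //; have : 0 <= j%:R :> R by []; lra.
rewrite ltr_pdivrMr // mul1r; have : j.+1%:R <= q%:R :> R by rewrite ler_nat ltn_ord.
rewrite -natr1; lra.
Qed.

Lemma cyclic_potential_gap (i j : 'I_q) : (i <= j)%N ->
  L / q%:R * (j%:R - i%:R) <= cyclic_potential j - cyclic_potential i.
Proof.
move=> ij; have [_ [_ [mono _]]] := v_UBLM.
have [i0 i1] := phase_itv i; have [j0 j1] := phase_itv j.
have := mono _ _ i0 _ j1; rewrite ler_pM2r ?invr_gt0 // lerD2r ler_nat => /(_ ij).
by apply: le_trans; rewrite le_eqVlt; apply/orP; left; apply/eqP; field; rewrite gt_eqF.
Qed.

Lemma cyclic_laplacian_sym : cyclic_laplacian^T = cyclic_laplacian.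
Proof.
apply/matrixP => x y; rewrite !mxE; apply: eq_bigr => i _; rewrite addrC; congr (_ + _).
  by rewrite eq_sym subr_eq.
by rewrite -subr_eq eq_sym.
Qed.

Lemma cyclic_laplacian_inv a x y : cyclic_laplacian (x + a) (y + a) = cyclic_laplacian x y.
Proof.
by rewrite !mxE; apply: eq_bigr => i _; rewrite ![y + a + _]addrAC !(inj_eq (addIr a)).
Qed.

Lemma sum_cyclic_laplacian (f : 'I_q -> R) y : \sum_x f x * cyclic_laplacian x y =
  \sum_(i < d) (f (y + residue n (dotp (unitv i))) + f (y - residue n (dotp (unitv i)))).
Proof.
have pick (a : 'I_q) : \sum_x f x * (x == a)%:R = f a.
  by rewrite (bigD1 a) //= eqxx mulr1 big1 ?addr0 // => x /negbTE ->; rewrite mulr0.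
transitivity (\sum_x \sum_(i < d) (f x * (x == y + residue n (dotp (unitv i)))%:R +
   f x * (x == y - residue n (dotp (unitv i)))%:R)).
  by apply: eq_bigr => x _; rewrite mxE mulr_sumr; apply: eq_bigr => i _; rewrite mulrDr.
by rewrite exchange_big; apply: eq_bigr => i _; rewrite big_split /= !pick.
Qed.

Lemma colnorm_cyclic_laplacian rho y : 0 <= rho ->
  colnorm (fun x y => expR (rho * (cdist w x y)%:R)) cyclic_laplacian y <= (2 * d)%:R * expR rho.
Proof.
move=> rho0; rewrite /colnorm.
have e1 x : `|cyclic_laplacian x y| * expR (rho * (cdist w x y)%:R) =
    expR (rho * (cdist w x y)%:R) * cyclic_laplacian x y.
  by rewrite mulrC ger0_norm // mxE sumr_ge0 // => i _; rewrite addr_ge0.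
rewrite (eq_bigr _ (fun x _ => e1 x)) sum_cyclic_laplacian.
have -> : (2 * d)%:R * expR rho = \sum_(i < d) (expR rho + expR rho).
  by rewrite sumr_const card_ord natrM -mulr_natl; ring.
apply: ler_sum => i _.
have hop z : norm1 z = 1%N -> expR (rho * (cdist w (y + residue n (dotp z)) y)%:R) <= expR rho.
  move=> z1; rewrite ler_expR ler_piMr // -[leRHS]/(1%:R) ler_nat /cdist addrAC subrr add0r -z1.
  exact: len_norm1.
apply: lerD; first by apply: hop; rewrite norm1_unitv.
by rewrite -residueN -dotpN; apply: hop; rewrite norm1N norm1_unitv.
Qed.

(** The radius within which the approximant is faithful: the first condition is the range of the
    rounded Diophantine bound, the second keeps the cap on word length out of play. Both hold for
    large [n] at any fixed [r > 0]. *)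
Definition scale_valid (r : nat) : bool :=
  (r%:R / q%:R <= gamma / 2 * powR r%:R (- tau)) && (r <= q)%N.

Lemma scale_valid_le r r' : scale_valid r -> (0 < r' <= r)%N ->
  r'%:R / q%:R <= gamma / 2 * powR r'%:R (- tau).
Proof.
move=> /andP[h _] /andP[r0 rr]; apply: (@le_trans _ _ (r%:R / q%:R)).
  by rewrite ler_pM2r ?invr_gt0 // ler_nat.
apply: le_trans h _; apply: ler_wpM2l; first by rewrite divr_ge0 // ltW.
rewrite !powRN lef_pV2 ?posrE ?powR_gt0 ?ltr0n // ?(leq_trans r0) //.
by apply: ge0_ler_powR; rewrite ?nnegrE ?ler_nat // ltW.
Qed.

(** A shorter word for the same residue would differ from [z] by a nonzero vector of norm at most
    [2 * norm1 z] whose rounded phase is an integer, against the Diophantine bound; hence the factor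
    2 in the hypothesis. *)
Lemma len_lower z : scale_valid (2 * norm1 z) -> (norm1 z <= len (residue n (dotp z)))%N.
Proof.
move=> ok; have [e|[z' z'l e]] := lenP w (residue n (dotp z)).
  rewrite e; move: ok => /andP[_]; apply: leq_trans; exact: leq_pmull.
rewrite leqNgt; apply/negP => lt; pose u := z - z'.
have u0 : u != 0.
  rewrite /u subr_eq0; apply: contraTneq (leq_ltn_trans z'l lt) => ->; by rewrite ltnn.
have ul : (norm1 u <= 2 * norm1 z)%N.
  rewrite (leq_trans (norm1D _ _)) // norm1N mul2n -addnn leq_add2l.
  exact: leq_trans z'l (ltnW lt).
have /residue_inj : residue n (dotp u) = residue n 0.
  by rewrite /u dotpD dotpN residueD residueN e subrr residue0.
rewrite mod0z => /dvdz_mod0P/dvdzP[l hl].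
have hp : (0 < norm1 u <= 2 * norm1 z)%N by rewrite lt0n norm1_eq0 u0 ul.
have := approx_DC w_DC l u0 (scale_valid_le ok hp).
rewrite hl rmorphM /= mulfK ?gt_eqF // subrr normr0 leNgt => /negP; apply.
by rewrite mulr_gt0 ?divr_gt0 // powR_gt0 // ltr0n; case/andP: hp.
Qed.

Variables (theta : R).

Definition approx_phase (x : Zd d) : R := ((Num.floor (q%:R * theta) + dotp x)%:~R + 1 / 2) / q%:R.

Definition site (x : Zd d) : 'I_q := residue n (Num.floor (q%:R * theta) + dotp x).

Lemma siteD x z : site (x + z) = site x + residue n (dotp z).
Proof. by rewrite /site -residueD dotpD addrA. Qed.

Lemma cyclic_potential_site x : cyclic_potential (site x) = v (approx_phase x).
Proof.
rewrite /cyclic_potential /approx_phase; have [l hl] := residue_mod n (Num.floor (q%:R * theta) + dotp x).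
have [s0 s1] := phase_itv (site x).
rewrite -(UBLM_periodic (- l) v_UBLM (open_unit_notin s0 s1)); congr v.
have -> : (site x)%:R = (Num.floor (q%:R * theta) + dotp x)%:~R + l%:~R * q%:R :> R.
  by have /(congr1 (fun k : int => k%:~R : R)) := hl; rewrite [in RHS]rmorphD rmorphM.
by rewrite rmorphN /=; field; rewrite gt_eqF.
Qed.

Variables (m : nat) (sig rho eps : R).
Hypothesis m_large : tau + 1 <= m%:R.
Hypothesis sig_gt0 : 0 < sig.
Hypothesis sig_small : sig <= 1 / 80.
Hypothesis sig_base : 8 * sig * (scale_base m)%:R ^+ m <= L * Num.min 1 (gamma / 2).
Hypothesis rho_ge1 : 1 <= rho.
Hypothesis eps_ge0 : 0 <= eps.
Hypothesis eps_small : eps * ((2 * d)%:R * expR rho) <= sig ^+ 2.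

Lemma lattice_approximant : exists (phi : Zd d -> Zd d -> R) (lam : Zd d -> R),
  [/\ forall x y, eps * Lap (phi x) y + v (approx_phase y) * phi x y = lam x * phi x y,
      forall x, phi x x = 1,
      forall x y, `|phi x y| <= 1,
      forall x y, x != y -> scale_valid (2 * norm1 (y - x)) ->
        `|phi x y| <= 1 / 4 * expR (- (rho / 2)) ^+ norm1 (y - x)
    & forall x y, x != y -> scale_valid (2 * norm1 (y - x)) ->
        L * (gamma / 2 * powR (norm1 (y - x))%:R (- tau)) <= `|lam y - lam x|].
Proof.
have m0 : (0 < m)%N by rewrite -(ltr0n R); apply: lt_le_trans m_large; rewrite addr_gt0.
have c0 : 0 < L * Num.min 1 (gamma / 2).
  by rewrite mulr_gt0 // lt_min ltr01 divr_gt0.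
have g0 : 0 < L / q%:R by rewrite divr_gt0.
have es y : eps * colnorm (fun x y => expR (rho * (cdist w x y)%:R)) cyclic_laplacian y <= sig ^+ 2.
  apply: le_trans eps_small; apply: ler_wpM2l => //; apply: colnorm_cyclic_laplacian.
  by apply: le_trans rho_ge1.
have [P [lam [PH gap Pd Pdec]]] := cyclic_localization cyclic_laplacian_sym cyclic_laplacian_inv
  g0 cyclic_potential_gap (cdist_id w (n := n)) (cdist_triangle w (n := n)) m0 c0
  (fun x y => cyclic_separated w_DC gamma_gt0 L_gt0 m_large m0) sig_gt0 sig_small sig_base rho_ge1 eps_ge0 es.
pose phi x y := P (site x) (site y) / P (site x) (site x).
have P0 k : 0 < `|P k k| by have := Pd k; lra.
(* Dividing the bound [1 / 5] by a diagonal entry of at least [9 / 10] gives [2 / 9], below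
   [1 / 4]. *)
have off k j : j != k -> `|P k j / P k k| <= 1 / 4 * expR (- (rho / 2)) ^+ cdist w j k.
  move=> jk; rewrite normrM normfV ler_pdivrMr //.
  have h1 : `|P k j| * expR (rho / 2 * (cdist w j k)%:R) <= 1 / 5.
    apply: le_trans (Pdec k); rewrite (bigD1 j jk) /= lerDl; apply: sumr_ge0 => x _.
    by rewrite mulr_ge0 // expR_ge0.
  have h2 : expR (rho / 2 * (cdist w j k)%:R) * expR (- (rho / 2)) ^+ cdist w j k = 1.
    by rewrite -expRM_natr mulNr -expRD subrr expR0.
  have h3 : 0 <= expR (- (rho / 2)) ^+ cdist w j k by rewrite exprn_ge0 // expR_ge0.
  have := Pd k; set a := `|P k j| in h1 *; set b := expR _ in h1 h2; set c := _ ^+ _ in h2 h3 *.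
  move=> h4; have -> : a = a * b * c by rewrite -mulrA h2 mulr1.
  apply: (@le_trans _ _ (1 / 5 * c)); first exact: ler_wpM2r.
  rewrite [leRHS]mulrAC; apply: ler_wpM2r => //; lra.
have site_ne x y : x != y -> scale_valid (2 * norm1 (y - x)) ->
    site y != site x /\ (norm1 (y - x) <= cdist w (site y) (site x))%N.
  move=> xy ok; have := len_lower ok.
  have e : site y - site x = residue n (dotp (y - x)) by rewrite -{1}(subrK x y) [y - x + x]addrC siteD addrC addKr.
  rewrite /cdist e => h; split=> //; rewrite -subr_eq0 e; apply: contraTneq h => ->.
  by rewrite len0 -ltnNge lt0n norm1_eq0 subr_eq0 eq_sym.
exists phi, (fun x => lam (site x)); split.
- move=> x y; have /rowP/(_ (site y)) := PH (site x).
  rewrite /schrodinger mulmxDr mxE mul_mx_diag -scalemxAr !mxE cyclic_potential_site.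
  rewrite (eq_bigr (fun j => P (site x) j * cyclic_laplacian j (site y))); last by move=> j _; rewrite mxE.
  rewrite sum_cyclic_laplacian => h; rewrite [RHS]mulrA -h /Lap mulrDl addrC; congr (_ + _).
    by rewrite mulrA [P _ _ * _]mulrC.
  rewrite -mulrA mulr_suml; congr (_ * _); apply: eq_bigr => i _.
  by rewrite /phi -mulrDl !siteD dotpN residueN.
- by move=> x; rewrite /phi divff // -normr_gt0.
- move=> x y; have [e|e] := eqVneq (site y) (site x); first by rewrite /phi e divff ?normr1 // -normr_gt0.
  apply: le_trans (off _ _ e) _; rewrite -[leRHS]mulr1.
  apply: ler_pM; [by lra|by rewrite exprn_ge0 // expR_ge0|by lra|].
  by rewrite exprn_ile1 ?expR_ge0 // expR_le1; have := rho_ge1; lra.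
- move=> x y xy ok; have [ne h] := site_ne x y xy ok.
  apply: le_trans (off _ _ ne) _; apply: ler_wpM2l => //.
  by apply: ler_wiXn2l; rewrite ?expR_ge0 // expR_le1; have := rho_ge1; lra.
- move=> x y xy ok; have [ne _] := site_ne x y xy ok.
  have e : residue n (dotp (y - x)) = site y - site x.
    by rewrite -{2}(subrK x y) [y - x + x]addrC siteD [RHS]addrC addKr.
  have [l hl] := @residue_diff R n _ _ _ e.
  have yx : y - x != 0 by rewrite subr_eq0 eq_sym.
  have hp : (0 < norm1 (y - x) <= 2 * norm1 (y - x))%N by rewrite lt0n norm1_eq0 yx leq_pmull.
  apply: (@le_trans _ _ (L * (`|(site y)%:R - (site x)%:R| / q%:R))).
    rewrite ler_pM2l // hl; exact: (approx_DC w_DC l yx (scale_valid_le ok hp)).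
  have gapn (i j : 'I_q) : (i <= j)%N -> L * (`|j%:R - i%:R| / q%:R) <= `|lam j - lam i|.
    move=> ij; rewrite ger0_norm ?subr_ge0 ?ler_nat // mulrCA mulrC.
    by apply: le_trans (gap _ _ ij) _; exact: ler_norm.
  have [h|h] := leqP (site x) (site y); first exact: gapn.
  by rewrite distrC [leRHS]distrC; exact/gapn/ltnW.
Qed.

End LatticeApproximant.

(** * Summation over the lattice *)

Import numFieldNormedType.Exports.
Local Open Scope classical_set_scope.

Definition box d N : seq (Zd d) :=
  [seq (\row_i ((k i : nat)%:Z - N%:Z) : Zd d) | k : {ffun 'I_d -> 'I_(N.*2.+1)}].

Section Boxes.
Variable d : nat.
Implicit Types (x : Zd d) (s : seq (Zd d)).

Lemma box_uniq N : uniq (box d N).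
Proof.
rewrite map_inj_uniq ?enum_uniq // => k1 k2 /rowP e; apply/ffunP => i.
by have := e i; rewrite !mxE => /(addIr _) [] /val_inj.
Qed.

Lemma mem_box N x : (x \in box d N) = [forall i, `|x ord0 i|%N <= N]%N.
Proof.
apply/mapP/forallP => [[k _ ->] i|h].
  rewrite mxE; move: (k i) => [a ha] /=; move: ha; clear. lia.
pose k := [ffun i : 'I_d => inord `|(x ord0 i + N%:Z)%R|%N : 'I_(N.*2.+1)].
exists k; first by rewrite mem_enum.
apply/rowP => i; rewrite mxE ffunE; move: (h i); move: (x ord0 i) => a {k x h} ha; rewrite inordK; lia.
Qed.

Lemma box_le N M : (N <= M)%N -> {subset box d N <= box d M}.
Proof. by move=> NM x; rewrite !mem_box => /forallP h; apply/forallP => i; apply: leq_trans NM. Qed.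

Lemma box_norm1 x : x \in box d (norm1 x).
Proof. by rewrite mem_box; apply/forallP => i; rewrite /norm1 (bigD1 i) //= leq_addr. Qed.

Lemma box_cover s : exists N, {subset s <= box d N}.
Proof.
elim: s => [|x s [N IH]]; first by exists 0%N.
exists (maxn (norm1 x) N) => y; rewrite inE => /orP[/eqP ->|/IH].
  exact: (box_le (leq_maxl _ _) (box_norm1 x)).
exact: (box_le (leq_maxr _ _)).
Qed.

Lemma box_shift N (i : 'I_d) x : x \in box d N -> x + unitv i \in box d N.+1 /\ x - unitv i \in box d N.+1.
Proof.
rewrite !mem_box => /forallP h; split; apply/forallP => j; move: (h j); rewrite !mxE /=; move: (x ord0 j) => a {h x}; case: (j == i) => /=; lia.
Qed.

End Boxes.

Section Summation.
Variables (R : realType) (d : nat).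
Implicit Types (F G : Zd d -> R) (s : seq (Zd d)).

Lemma box_sumE N F : box_sum N F = \sum_(x <- box d N) F x.
Proof. by rewrite /box_sum big_map enumT. Qed.

Lemma sum_subset F s s' : (forall x, 0 <= F x) -> uniq s -> uniq s' -> {subset s <= s'} ->
  \sum_(x <- s) F x <= \sum_(x <- s') F x.
Proof.
move=> F0 us us' ss'; rewrite [leRHS](bigID (mem s)) /= -[X in _ <= X + _]big_filter.
rewrite [X in _ <= X + _](_ : _ = \sum_(x <- s) F x); first by rewrite lerDl sumr_ge0.
apply: perm_big; apply: uniq_perm => //; first exact: filter_uniq.
by move=> x; rewrite mem_filter; apply/andP/idP => [[]|h] //; split=> //; exact: ss'.
Qed.

(** Finite sets instead of boxes make the notion invariant under translations. *)
Definition summable F := exists M, forall s, uniq s -> \sum_(x <- s) `|F x| <= M.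

Lemma le_summable F G : summable F -> (forall x, `|G x| <= `|F x|) -> summable G.
Proof. by move=> [M h] FG; exists M => s us; apply: le_trans (h s us); apply: ler_sum. Qed.

Lemma summableD F G : summable F -> summable G -> summable (fun x => F x + G x).
Proof.
move=> [M hM] [M' hM']; exists (M + M') => s us.
apply: le_trans (lerD (hM s us) (hM' s us)); rewrite -big_split; apply: ler_sum => x _.
exact: ler_normD.
Qed.

Lemma summable_shift F (a : Zd d) : summable F -> summable (fun x => F (x + a)).
Proof.
move=> [M h]; exists M => s us; have := h [seq x + a | x <- s]; rewrite big_map; apply.
by rewrite map_inj_uniq //; exact: addIr.
Qed.

Lemma summable_box F M : (forall N, box_sum N (fun x => `|F x|) <= M) -> summable F.
Proof.
move=> h; exists M => s us; have [N sN] := box_cover s.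
by apply: le_trans (h N); rewrite box_sumE; apply: sum_subset => //; exact: box_uniq.
Qed.

Lemma summable_tail F : summable F -> forall e, 0 < e ->
  exists N, forall s, uniq s -> (forall x, x \in s -> x \notin box d N) -> \sum_(x <- s) `|F x| <= e.
Proof.
move=> [M h] e e0.
pose A := [set r | exists2 s, uniq s & r = \sum_(x <- s) `|F x|].
have hA : has_sup A.
  split; first by exists 0; exists [::] => //; rewrite big_nil.
  by exists M => _ [s us ->]; exact: h.
have [_ [s0 us0 ->] hs0] := sup_adherent e0 hA.
have [N sN] := box_cover s0; exists N => s us hs.
have : \sum_(x <- s0 ++ s) `|F x| <= sup A.
  apply: sup_upper_bound => //; exists (s0 ++ s) => //; rewrite cat_uniq us0 us andbT /=.
  by apply/hasPn => x /hs; apply: contraNN; exact: sN.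
rewrite big_cat /=; lra.
Qed.

Lemma box_sum_tail F N0 (e : R) : (forall s, uniq s -> (forall x, x \in s -> x \notin box d N0) ->
    \sum_(x <- s) `|F x| <= e) -> forall s s', uniq s -> uniq s' ->
  {subset box d N0 <= s} -> {subset box d N0 <= s'} ->
  `|\sum_(x <- s) F x - \sum_(x <- s') F x| <= 2 * e.
Proof.
move=> tail s s' us us' hs hs'.
have split t t' : uniq t -> uniq t' -> \sum_(x <- t) F x =
    \sum_(x <- t | x \in t') F x + \sum_(x <- [seq x <- t | x \notin t']) F x.
  by move=> ut ut'; rewrite big_filter [LHS](bigID (mem t')).
have bnd (t t' : seq (Zd d)) : uniq t -> {subset box d N0 <= t'} -> `|\sum_(x <- [seq x <- t | x \notin t']) F x| <= e.
  move=> ut ht'; rewrite (le_trans (ler_norm_sum _ _ _)) // tail ?filter_uniq // => x.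
  by rewrite mem_filter => /andP[h _]; apply: contraNN h; exact: ht'.
rewrite (split s s') // (split s' s) //.
have -> : \sum_(x <- s' | x \in s) F x = \sum_(x <- s | x \in s') F x.
  rewrite -[LHS]big_filter -[RHS]big_filter; apply: perm_big; apply: uniq_perm; rewrite ?filter_uniq // => x.
  by rewrite !mem_filter andbC.
rewrite opprD addrACA subrr add0r; apply: le_trans (ler_normB _ _) _.
by rewrite mulr_natl mulr2n lerD // bnd.
Qed.

Lemma box_sum_cvg F : summable F -> cvgn (fun N => box_sum N F).
Proof.
move=> sF; apply: cauchy_cvg; apply/cauchy_exP => /= e e0.
have e2 : 0 < e / 4 by rewrite divr_gt0.
have [N0 tail] := summable_tail sF e2.
exists (box_sum N0 F); exists N0 => // N /= N0N; rewrite /ball_ /=.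
rewrite !box_sumE; apply: (@le_lt_trans _ _ (2 * (e / 4))); last by lra.
apply: (box_sum_tail tail); try exact: box_uniq; exact: box_le.
Qed.

(** Both the box and its translate contain a fixed smaller box outside of which [F] has little mass,
    so the boundary need not be examined. This is the vanishing of the flux at infinity in Green's
    identity. *)
Lemma box_sum_shift F (i : 'I_d) : summable F ->
  (fun N => box_sum N (fun x => F x - F (x - unitv i))) @ \oo --> (0 : R).
Proof.
move=> sF; apply/cvgrPdist_le => /= e e0.
have e2 : 0 < e / 2 by rewrite divr_gt0.
have [N0 tail] := summable_tail sF e2.
exists N0.+1 => // N /= N0N; rewrite sub0r normrN box_sumE sumrB.
have -> : \sum_(x <- box d N) F (x - unitv i) = \sum_(x <- [seq x - unitv i | x <- box d N]) F x.
  by rewrite [RHS]big_map.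
have -> : e = 2 * (e / 2) by field.
apply: (box_sum_tail tail).
- exact: box_uniq.
- by rewrite map_inj_uniq ?box_uniq //; exact: addIr.
- exact/box_le/ltnW.
- move=> x xN; apply/mapP; exists (x + unitv i); last by rewrite addrK.
  by apply: (box_le N0N); case: (box_shift i xN).
Qed.

End Summation.

Lemma cvg_finsum (R : realType) (T : Type) (F : set_system T) {FF : Filter F} (J : Type) (r : seq J)
  (f : J -> T -> R) (a : J -> R) : (forall j, f j @ F --> a j) ->
  (fun t => \sum_(j <- r) f j t) @ F --> \sum_(j <- r) a j.
Proof.
move=> fa; elim: r => [|j r IH].
  by rewrite big_nil (_ : (fun _ => _) = cst 0); [exact: cvg_cst|apply/funext => t; rewrite big_nil].
rewrite big_cons (_ : (fun _ => _) = (fun t => f j t + \sum_(i <- r) f i t)).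
  exact: cvgD.
by apply/funext => t; rewrite big_cons.
Qed.

Section SquareSummable.
Variables (R : realType) (d : nat).
Implicit Types (f g h : Zd d -> R).

Lemma l2_summable f : l2 f -> summable (fun x => f x ^+ 2).
Proof.
move=> [M hM]; apply: (summable_box (M := M)) => N; apply: le_trans (hM N).
by rewrite !box_sumE; apply: ler_sum => x _; rewrite ger0_norm // sqr_ge0.
Qed.

Lemma summable_l2 f : summable (fun x => f x ^+ 2) -> l2 f.
Proof.
move=> [M hM]; exists M => N; apply: le_trans (hM _ (box_uniq d N)).
by rewrite box_sumE; apply: ler_sum => x _; exact: ler_norm.
Qed.

Lemma l2_mul f g : l2 f -> l2 g -> summable (fun x => f x * g x).
Proof.
move=> /l2_summable sf /l2_summable sg; apply: le_summable (summableD sf sg) _ => x.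
rewrite [leRHS]ger0_norm ?addr_ge0 ?sqr_ge0 //; set a := f x; set b := g x.
by rewrite ler_norml; apply/andP; split; nra.
Qed.

Lemma l2_lin f g c : l2 f -> l2 g -> l2 (fun x => f x - c * g x).
Proof.
move=> /l2_summable [M hM] /l2_summable [M' hM'].
apply: summable_l2; exists (2 * M + 2 * c ^+ 2 * M') => s us.
apply: (@le_trans _ _ (2 * (\sum_(x <- s) `|f x ^+ 2|) + 2 * c ^+ 2 * (\sum_(x <- s) `|g x ^+ 2|))).
  rewrite !mulr_sumr -big_split; apply: ler_sum => x _ /=.
  by rewrite !ger0_norm ?sqr_ge0 //; set a := f x; set b := g x; have := sqr_ge0 (a + c * b); nra.
apply: lerD; apply: ler_wpM2l => //; [exact: hM| |exact: hM'].
by rewrite mulr_ge0 // sqr_ge0.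
Qed.

Lemma l2_shift f (a : Zd d) : l2 f -> l2 (fun x => f (x + a)).
Proof. by move=> /l2_summable /(summable_shift a) h; exact: summable_l2. Qed.

Lemma l2_bounded f : l2 f -> exists B, forall x, `|f x| <= B.
Proof.
move=> [M hM]; exists (1 + M) => x.
have h : f x ^+ 2 <= M.
  apply: le_trans (hM (norm1 x)); rewrite box_sumE (bigD1_seq x) ?box_uniq ?box_norm1 //=.
  by rewrite lerDl sumr_ge0 // => y _; exact: sqr_ge0.
by rewrite ler_norml; move: h; set a := f x; move=> h; apply/andP; split; nra.
Qed.

Lemma l2inner_cvg f g : l2 f -> l2 g -> (fun N => box_sum N (fun x => f x * g x)) @ \oo --> l2inner f g.
Proof. by move=> lf lg; have := box_sum_cvg (l2_mul lf lg). Qed.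

Lemma l2innerC f g : l2inner f g = l2inner g f.
Proof.
rewrite /l2inner (_ : (fun N => box_sum N (fun x => f x * g x)) = (fun N => box_sum N (fun x => g x * f x))) //.
by apply/funext => N; rewrite !box_sumE; apply: eq_bigr => x _; rewrite mulrC.
Qed.

Lemma l2inner_lin f g h c : l2 f -> l2 g -> l2 h ->
  l2inner (fun x => f x - c * g x) h = l2inner f h - c * l2inner g h.
Proof.
move=> lf lg lh; apply/cvg_lim => //.
have -> : (fun N => box_sum N (fun x => (f x - c * g x) * h x)) =
    (fun N => box_sum N (fun x => f x * h x) - c * box_sum N (fun x => g x * h x)).
  apply/funext => N; rewrite !box_sumE mulr_sumr -sumrB; apply: eq_bigr => x _; ring.
by apply: cvgB; [exact: l2inner_cvg|apply: cvgMl_tmp; exact: l2inner_cvg].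
Qed.

Lemma l2innerZ f h c : l2 f -> l2 h -> l2inner (fun x => c * f x) h = c * l2inner f h.
Proof.
move=> lf lh; apply/cvg_lim => //.
have -> : (fun N => box_sum N (fun x => (c * f x) * h x)) =
    (fun N => c * box_sum N (fun x => f x * h x)).
  apply/funext => N; rewrite !box_sumE mulr_sumr; apply: eq_bigr => x _; ring.
by apply: cvgMl_tmp; exact: l2inner_cvg.
Qed.

Lemma l2inner_ge f x : l2 f -> f x ^+ 2 <= l2inner f f.
Proof.
move=> lf; apply: limr_ge; first exact: l2inner_cvg.
exists (norm1 x) => // N /= xN; rewrite box_sumE (bigD1_seq x) ?box_uniq //=; last exact: box_le xN _ (box_norm1 x).
by rewrite -expr2 lerDl sumr_ge0 // => y _; rewrite -expr2 sqr_ge0.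
Qed.

End SquareSummable.

Section Operator.
Variables (R : realType) (d : nat) (eps theta : R) (v : R -> R) (w : 'I_d -> R).
Implicit Types (f g : Zd d -> R).
Local Notation H := (Hop eps v w theta).

(** The unbounded potential cancels pointwise in [(H f) g - f (H g)], and what remains is a discrete
    divergence of the summable currents [h i], whose box sums tend to 0. *)
Lemma eigenfunctions_orthogonal f g E E' : l2 f -> l2 g ->
  (forall x, H f x = E * f x) -> (forall x, H g x = E' * g x) -> E != E' -> l2inner f g = 0.
Proof.
move=> lf lg Hf Hg EE.
pose h i x := f (x + unitv i) * g x - f x * g (x + unitv i).
have sh i : summable (h i).
  have s2 : summable (fun x => - (f x * g (x + unitv i))).
    by apply: le_summable (l2_mul lf (l2_shift (unitv i) lg)) _ => x; rewrite normrN.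
  by apply: le_summable (summableD (l2_mul (l2_shift (unitv i) lf) lg) s2) _ => x.
have key : (fun N => (E - E') * box_sum N (fun x => f x * g x)) @ \oo --> (0 : R).
  have -> : (fun N => (E - E') * box_sum N (fun x => f x * g x)) =
      (fun N => eps * \sum_(i < d) box_sum N (fun x => h i x - h i (x - unitv i))).
    apply/funext => N; rewrite !box_sumE !mulr_sumr.
    rewrite [RHS](eq_bigr (fun i => \sum_(x <- box d N) eps * (h i x - h i (x - unitv i)))); last first.
      by move=> i _; rewrite box_sumE mulr_sumr.
    rewrite exchange_big /=; apply: eq_bigr => x _; rewrite -mulr_sumr.
    have -> : (E - E') * (f x * g x) = (H f x) * g x - f x * (H g x) by rewrite Hf Hg; ring.
    rewrite /Hop.
    have -> : (eps * Lap f x + v (theta + dotw x w) * f x) * g x -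
        f x * (eps * Lap g x + v (theta + dotw x w) * g x) = eps * (Lap f x * g x - f x * Lap g x) by ring.
    congr (_ * _); rewrite /Lap mulr_suml mulr_sumr -sumrB; apply: eq_bigr => i _.
    by rewrite /h subrK; ring.
  have h0 := @cvg_finsum R nat \oo _ _ (index_enum 'I_d)
    (fun i N => box_sum N (fun x => h i x - h i (x - unitv i))) (fun _ => 0) (fun i => box_sum_shift i (sh i)).
  have e0 : eps * \sum_(j <- index_enum 'I_d) (0 : R) = 0 by rewrite big1 ?mulr0.
  by rewrite -[X in _ --> X]e0; apply: cvgMl_tmp; exact: (h0 _).
have key2 : (fun N => (E - E') * box_sum N (fun x => f x * g x)) @ \oo --> (E - E') * l2inner f g.
  by apply: cvgMl_tmp; exact: l2inner_cvg.
have e1 := cvg_lim (@Rhausdorff R) key; have e2 := cvg_lim (@Rhausdorff R) key2.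
have /eqP : (E - E') * l2inner f g = 0 by rewrite -e2 -[RHS]e1.
by rewrite mulf_eq0 subr_eq0 (negbTE EE) /= => /eqP.
Qed.

End Operator.

Section Geometric.
Variables (R : realType) (d : nat) (t : R).
Hypothesis t_ge0 : 0 <= t.
Hypothesis t_half : t <= 1 / 2.

(** The right-hand side is the exact value of the sum at [t = 1 / 2], a form that closes the
    induction. *)
Lemma sum_geometric_line N : \sum_(k < N.*2.+1) t ^+ `|(k : nat)%:Z - N%:Z|%N <= 3 - 2 * 2^-1 ^+ N.
Proof.
elim: N => [|N IH]; first by rewrite big_ord_recl big_ord0 /= expr0 addr0; lra.
have -> : \sum_(k < N.+1.*2.+1) t ^+ `|(k : nat)%:Z - N.+1%:Z|%N =
    t ^+ N.+1 + (\sum_(k < N.*2.+1) t ^+ `|(k : nat)%:Z - N%:Z|%N + t ^+ N.+1).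
  rewrite doubleS big_ord_recl big_ord_recr; congr (_ + (_ + _)).
  - by congr (_ ^+ _); rewrite /=; lia.
  - by apply: eq_bigr => i _; congr (_ ^+ _); rewrite /= /bump leq0n add1n; move: (nat_of_ord i) => j {i}; clear; lia.
  - by congr (_ ^+ _); rewrite /= /bump leq0n add1n; clear; lia.
have : t ^+ N.+1 <= 2^-1 ^+ N.+1.
  by apply: lerXn2r; rewrite ?nnegrE ?invr_ge0 // -[leRHS]mul1r.
move: IH; rewrite [2^-1 ^+ N.+1]exprS; set a := \sum_(_ < _) _; set b := t ^+ _; set c := 2^-1 ^+ _; lra.
Qed.

Lemma sum_geometric_origin (s : seq (Zd d)) : uniq s -> \sum_(x <- s) t ^+ norm1 x <= 3 ^+ d.
Proof.
move=> us; have [N sN] := box_cover s.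
apply: (@le_trans _ _ (\sum_(x <- box d N) t ^+ norm1 x)).
  by apply: sum_subset => //; [move=> x; exact: exprn_ge0|exact: box_uniq].
rewrite -box_sumE /box_sum.
apply: (@le_trans _ _ (\prod_(i < d) \sum_(k < N.*2.+1) t ^+ `|(k : nat)%:Z - N%:Z|%N)).
  rewrite bigA_distr_bigA /=; apply: ler_sum => k _; rewrite -expr_sum.
  by rewrite /norm1 (eq_bigr (fun i => `|(k i : nat)%:Z - N%:Z|%N)) // => i _; rewrite mxE.
rewrite -[X in _ <= _ ^+ X](card_ord d) -prodr_const; apply: ler_prod => i _.
apply/andP; split; first by rewrite sumr_ge0 // => j _; exact: exprn_ge0.
apply: le_trans (sum_geometric_line N) _; rewrite lerBlDr lerDl mulr_ge0 // exprn_ge0 // invr_ge0.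
Qed.

Lemma sum_geometric (s : seq (Zd d)) a : uniq s -> \sum_(x <- s) t ^+ norm1 (x - a) <= 3 ^+ d.
Proof.
move=> us; have := @sum_geometric_origin [seq x - a | x <- s]; rewrite big_map; apply.
by rewrite map_inj_uniq //; exact: addIr.
Qed.

End Geometric.

(** * Complete families of localized modes *)

Lemma enum_Zd d : (0 < d)%N -> exists e : nat -> Zd d, bijective e.
Proof.
move=> d0.
have inf : ~ finite_set [set: Zd d].
  move=> fin; apply: infinite_nat.
  have <- : (fun k : nat => const_mx k%:Z : Zd d) @^-1` [set: Zd d] = [set: nat] by rewrite preimage_setT.
  apply: finite_preimage fin => k l _ _ /rowP/(_ (Ordinal d0)); by rewrite !mxE => -[].
have := eq_card_nat (countableP [set: Zd d]) inf.
move=> /card_set_bijP[f [_ fi fs]].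
have fs' k : exists x, f x = k by have [x _ <-] := fs k I; exists x.
have [e he] := choice fs'; exists e, f => [k|x]; first exact: he.
by apply: fi; rewrite ?inE //; exact: he.
Qed.

Section LocalizedFamily.
Variables (R : realType) (d : nat) (eps theta t : R) (v : R -> R) (w : 'I_d -> R).
Local Notation H := (Hop eps v w theta).
Variables (phi : Zd d -> Zd d -> R) (lam : Zd d -> R).
Hypothesis d_gt0 : (0 < d)%N.
Hypothesis t_ge0 : 0 <= t.
Hypothesis t_half : t <= 1 / 2.
Hypothesis t_small : t * 3 ^+ d <= 1.
Hypothesis phi_eigen : forall x y, H (phi x) y = lam x * phi x y.
Hypothesis phi_id : forall x, phi x x = 1.
Hypothesis phi_decay : forall x y, x != y -> `|phi x y| <= 1 / 4 * (t ^+ 2) ^+ norm1 (y - x).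
Hypothesis lam_inj : injective lam.

Let t_le1 : t <= 1.
Proof. by apply: le_trans t_half _; lra. Qed.

Lemma mode_bound x y : `|phi x y| <= (t ^+ 2) ^+ norm1 (y - x).
Proof.
have [<-|xy] := eqVneq x y; first by rewrite phi_id normr1 subrr norm1_0.
apply: le_trans (phi_decay xy) _; rewrite ler_piMl ?exprn_ge0 //; lra.
Qed.

Lemma mode_l2 x : l2 (phi x).
Proof.
apply: summable_l2; exists (3 ^+ d) => s us; apply: le_trans (sum_geometric t_ge0 t_half x us).
apply: ler_sum => y _; rewrite ger0_norm ?sqr_ge0 // -real_normK ?num_real //.
apply: (@le_trans _ _ (((t ^+ 2) ^+ norm1 (y - x)) ^+ 2)).
  by apply: lerXn2r; rewrite ?nnegrE ?exprn_ge0 ?mode_bound.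
by rewrite -!exprM; apply: ler_wiXn2l => //; lia.
Qed.

Lemma mode_complete f : l2 f -> (forall x, l2inner f (phi x) = 0) -> f = (fun _ => 0).
Proof.
move=> lf f0; have [B hB] := l2_bounded lf.
(* Orthogonality to [phi x] expresses [f x] through the other values of [f], with weights of total
   modulus at most [1 / 4]; iterating this forces [f = 0]. *)
have contract C : (forall x, `|f x| <= C) -> forall x, `|f x| <= C / 4.
  move=> hC x; have C0 : 0 <= C by apply: le_trans (hC 0).
  have hN N : (norm1 x <= N)%N -> `|f x| <= `|box_sum N (fun y => f y * phi x y)| + C / 4.
    move=> xN; rewrite box_sumE (bigD1_seq x) ?box_uniq //=; last exact: box_le xN _ (box_norm1 x).
    rewrite phi_id mulr1; set r := \sum_(_ <- _ | _) _.
    have hr : `|r| <= C / 4.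
      rewrite /r (le_trans (ler_norm_sum _ _ _)) //.
      (* Away from [x], the decay [t ^+ 2] per unit of distance leaves one spare factor [t], which
         pays for the lattice sum [3 ^+ d]. *)
      apply: (@le_trans _ _ (\sum_(y <- box d N | y != x) C * (1 / 4 * (t * t ^+ norm1 (y - x))))).
        apply: ler_sum => y yx; rewrite normrM; apply: ler_pM => //.
        apply: le_trans (phi_decay _) _; first by rewrite eq_sym.
        apply: ler_wpM2l => //; rewrite -exprS -exprM; apply: ler_wiXn2l => //.
        have : (0 < norm1 (y - x))%N by rewrite lt0n norm1_eq0 subr_eq0.
        by move: (norm1 (y - x)) => k; clear; lia.
      rewrite -!mulr_sumr; apply: ler_wpM2l => //.
      apply: (@le_trans _ _ (1 / 4 * 1)); last by rewrite mulr1 mul1r.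
      apply: ler_wpM2l => //; apply: le_trans t_small; apply: ler_wpM2l => //.
      by rewrite -big_filter; apply: sum_geometric => //; rewrite filter_uniq // box_uniq.
    have := ler_normB (f x + r) r; rewrite addrK; lra.
  have cv : (fun N => `|box_sum N (fun y => f y * phi x y)| + C / 4) @ \oo --> `|0 : R| + C / 4.
    apply: cvgD; last exact: cvg_cst.
    by apply: cvg_norm; rewrite -(f0 x); apply: l2inner_cvg => //; exact: mode_l2.
  rewrite -[leRHS]add0r -[X in X + _](@normr0 _ R) -(cvg_lim (@Rhausdorff R) cv).
  apply: limr_ge; first by apply/cvg_ex; eexists; exact: cv.
  by exists (norm1 x).
have iter k x : `|f x| <= B * (4^-1) ^+ k.
  elim: k x => [|k IH] x; first by rewrite expr0 mulr1.
  by rewrite exprSr mulrA; exact: contract.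
apply/funext => x; apply/eqP; rewrite -normr_le0.
have cv : (fun k => B * (4^-1) ^+ k) @ \oo --> B * 0.
  by apply: cvgMl_tmp; apply: cvg_expr; rewrite ger0_norm ?invr_ge0 // invf_lt1 // ltr1n.
rewrite -[leRHS](mulr0 B) -(cvg_lim (@Rhausdorff R) cv).
apply: limr_ge; first by apply/cvg_ex; eexists; exact: cv.
by exists 0%N.
Qed.

Let nrm x := Num.sqrt (l2inner (phi x) (phi x)).

Let nrm_ge1 x : 1 <= nrm x.
Proof.
rewrite /nrm -[leLHS]sqrtr1; apply: ler_wsqrtr.
by have := l2inner_ge x (mode_l2 x); rewrite phi_id expr1n.
Qed.

Let nrm2 x : l2inner (phi x) (phi x) = nrm x ^+ 2.
Proof.
rewrite sqr_sqrtr //; apply: le_trans (l2inner_ge x (mode_l2 x)); exact: sqr_ge0.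
Qed.

Let psi x y := (nrm x)^-1 * phi x y.

Let nrm_gt0 x : 0 < nrm x.
Proof. exact: lt_le_trans (nrm_ge1 x). Qed.

Lemma normalized_bound x y : `|psi x y| <= (t ^+ 2) ^+ norm1 (y - x).
Proof.
rewrite normrM normfV [`|nrm x|]ger0_norm ?(ltW (nrm_gt0 x)) //.
apply: le_trans (mode_bound x y); rewrite ler_piMl // invf_le1 //.
Qed.

Lemma normalized_l2 x : l2 (psi x).
Proof.
apply: summable_l2; apply: le_summable (l2_summable (mode_l2 x)) _ => y.
rewrite !normrX; apply: lerXn2r; rewrite ?nnegrE // normrM ler_piMl //.
by rewrite normfV [`|nrm x|]ger0_norm ?(ltW (nrm_gt0 x)) // invf_le1.
Qed.

Lemma normalized_eigen x y : H (psi x) y = lam x * psi x y.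
Proof.
have -> : H (psi x) y = (nrm x)^-1 * H (phi x) y.
  rewrite /Hop /Lap /psi mulrDr [RHS]addrC [LHS]addrC; congr (_ + _); first by ring.
  rewrite !mulr_sumr; apply: eq_bigr => i _; ring.
by rewrite phi_eigen mulrCA.
Qed.

Lemma normalized_inner x y : l2inner (psi x) (psi y) = (x == y)%:R.
Proof.
have [<-|xy] := eqVneq x y; last first.
  apply: (@eigenfunctions_orthogonal _ _ eps theta v w _ _ (lam x) (lam y)); try exact: normalized_l2.
  - exact: normalized_eigen.
  - exact: normalized_eigen.
  - by apply: contraNneq xy => /lam_inj ->.
rewrite l2innerZ; [|exact: mode_l2|exact: normalized_l2].
rewrite l2innerC l2innerZ; [|exact: mode_l2|exact: mode_l2].
by rewrite nrm2 expr2 mulKf ?gt_eqF // mulVf // gt_eqF.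
Qed.

Lemma normalized_complete f : l2 f -> (forall x, l2inner f (psi x) = 0) -> f = (fun _ => 0).
Proof.
move=> lf h; apply: mode_complete => // x; have := h x.
rewrite l2innerC l2innerZ //; last exact: mode_l2.
move=> /eqP; rewrite mulf_eq0 invr_eq0 gt_eqF //= l2innerC => /eqP //.
Qed.

Lemma normalized_expdecay x : exp_decaying (psi x).
Proof.
exists (2 ^+ norm1 x), (ln 2); split; first by rewrite ln_gt0 // ltr1n.
move=> y; rewrite mulNr expRN expRM_natr lnK ?posrE // -exprVn.
apply: le_trans (normalized_bound x y) _; rewrite -exprM.
apply: (@le_trans _ _ (2^-1 ^+ norm1 (y - x))).
  apply: (@le_trans _ _ (t ^+ norm1 (y - x))); first by apply: ler_wiXn2l => //; lia.
  by apply: lerXn2r; rewrite ?nnegrE ?invr_ge0 // -[leRHS]mul1r.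
have h : (norm1 y <= norm1 (y - x) + norm1 x)%N by rewrite -{1}(subrK x y) norm1D.
have -> : 2^-1 ^+ norm1 (y - x) = 2^-1 ^+ (norm1 (y - x) + norm1 x) * 2 ^+ norm1 x :> R.
  by rewrite exprD -mulrA -exprMn mulVf ?expr1n ?mulr1.
rewrite mulrC; apply: ler_wpM2l; first exact: exprn_ge0.
by apply: ler_wiXn2l => //; rewrite ?invr_ge0 // invf_le1 // ler1n.
Qed.

Lemma localized_anderson : anderson_loc H.
Proof.
have [e [g eg ge]] := enum_Zd d_gt0.
exists (fun n => psi (e n)), (fun n => lam (e n)); split; last by move=> n; exact: normalized_expdecay.
split; first by move=> n; exact: normalized_l2.
split; first by move=> n x; exact: normalized_eigen.
split; first by move=> n m; rewrite normalized_inner (can_eq eg); case: eqP.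
move=> f lf h; apply: normalized_complete => // x; rewrite -(ge x); exact: h.
Qed.

(* Simplicity of the spectrum forces every eigenbasis to consist of signed modes, in some order. *)
Lemma eigenbasis_modes chi E : eigenbasis H chi E ->
  exists2 xi : nat -> Zd d, injective xi & forall n y, `|chi n y| = `|psi (xi n) y|.
Proof.
move=> [lchi [chiE [ortho _]]].
have ex n : exists x, l2inner (chi n) (psi x) != 0.
  apply: contrapT => hn; have c0 : chi n = (fun _ => 0).
    apply: normalized_complete => // x; apply/eqP; apply: contrapT => /negP h; apply: hn; by exists x.
  have := ortho n n; rewrite eqxx c0 => h.
  have : l2inner (fun _ : Zd d => 0 : R) (fun _ => 0) = 0 * l2inner (chi n) (chi n).
    by rewrite -l2innerZ // c0; congr l2inner; apply/funext => x; rewrite mulr0.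
  by rewrite mul0r h => /eqP; rewrite oner_eq0.
have [xi hxi] := choice ex.
pose c n := l2inner (chi n) (psi (xi n)).
have chiP n : chi n = (fun y => c n * psi (xi n) y).
  have En : E n = lam (xi n).
    apply/eqP; apply: contraT => En; move: (hxi n); apply: contraNT => _.
    apply/eqP; apply: (@eigenfunctions_orthogonal _ _ eps theta v w _ _ (E n) (lam (xi n))) => //.
      exact: normalized_l2.
    exact: normalized_eigen.
  (* The remainder is orthogonal to [psi (xi n)] by the choice of [c n], and to the other modes
     because their eigenvalues differ from [E n]; completeness kills it. *)
  have : (fun y => chi n y - c n * psi (xi n) y) = (fun _ => 0).
    apply: normalized_complete; first by apply: l2_lin => //; exact: normalized_l2.
    move=> x; rewrite l2inner_lin //; try exact: normalized_l2.
    rewrite normalized_inner; have [<-|xx] := eqVneq (xi n) x; first by rewrite mulr1 subrr.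
    rewrite mulr0 subr0; apply: (@eigenfunctions_orthogonal _ _ eps theta v w _ _ (E n) (lam x)) => //.
    - exact: normalized_l2.
    - exact: normalized_eigen.
    - by rewrite En; apply: contraNneq xx => /lam_inj ->.
  by move=> h; apply/funext => y; apply/eqP; rewrite -subr_eq0; have /(congr1 (@^~ y)) /= -> := h.
have cc n m : l2inner (chi n) (chi m) = c n * c m * (xi n == xi m)%:R.
  rewrite [in LHS](chiP n) l2innerZ //; last exact: normalized_l2.
  rewrite l2innerC [in LHS](chiP m) l2innerZ; try exact: normalized_l2.
  by rewrite normalized_inner eq_sym mulrA.
have c2 n : `|c n| = 1.
  have := cc n n; rewrite ortho !eqxx mulr1 => /esym/eqP; rewrite -expr2 sqrf_eq1.
  by move=> /orP[/eqP ->|/eqP ->]; rewrite ?normrN normr1.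
have c0 n : c n != 0 by rewrite -normr_eq0 c2 oner_eq0.
exists xi => [n m e|n y].
  apply/eqP; apply: contraT => nm; have := cc n m; rewrite ortho (negbTE nm) e eqxx mulr1 => /esym/eqP.
  by rewrite mulf_eq0 !(negbTE (c0 _)).
by rewrite [in LHS]chiP normrM c2 mul1r.
Qed.

(** Absolute convergence comes first, since [limn] carries no information for a divergent series. *)
Lemma series_bound (u : nat -> R) M : (forall N, \sum_(0 <= n < N) `|u n| <= M) ->
  `|limn (series u)| <= M.
Proof.
move=> h; have cv : cvgn [normed series u].
  apply: nondecreasing_is_cvgn.
    by apply: nondecreasing_series => n _ _; exact: normr_ge0.
  by exists M => _ [N _ <-]; exact: h.
apply: le_trans (lim_series_norm cv) _; apply: limr_le => //.
by exists 0%N => // N _; exact: h.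
Qed.

Lemma localized_propagation chi E : eigenbasis H chi E ->
  exists C, forall x y s, prop_abs chi E s x y <= C * t ^+ norm1 (x - y).
Proof.
move=> /eigenbasis_modes[xi xi_inj chiE]; exists (2 * 3 ^+ d) => x y s.
have bound (a : nat -> R) : (forall n, `|a n| <= 1) ->
    `|limn (series (fun n => a n * chi n x * chi n y))| <= 3 ^+ d * t ^+ norm1 (x - y).
  move=> a1; apply: series_bound => N.
  apply: (@le_trans _ _ (\sum_(0 <= n < N) (t ^+ norm1 (xi n - x) * t ^+ norm1 (x - y)))); last first.
    rewrite -mulr_suml; apply: ler_wpM2r; first exact: exprn_ge0.
    have := sum_geometric t_ge0 t_half x (s := [seq xi n | n <- index_iota 0 N]).
    by rewrite big_map; apply; rewrite map_inj_uniq // iota_uniq.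
  apply: ler_sum => n _; rewrite !normrM !chiE.
  apply: (@le_trans _ _ (`|psi (xi n) x| * `|psi (xi n) y|)).
    by apply: ler_wpM2r => //; rewrite ler_piMl.
  apply: le_trans (ler_pM _ _ (normalized_bound _ _) (normalized_bound _ _)) _ => //.
  (* The exponent is twice the sum of the distances from the centre [xi n] to [x] and to [y]. One
     copy dominates [norm1 (x - y)] by the triangle inequality; the other makes the sum over the
     distinct centres converge. *)
  rewrite -!exprM -!exprD; apply: ler_wiXn2l => //.
  have h : (norm1 (x - y) <= norm1 (x - xi n) + norm1 (y - xi n))%N.
    by rewrite -(subrKA (xi n)) -[norm1 (y - _)]norm1N opprB norm1D.
  rewrite -(norm1N (xi n - x)) opprB.
  by move: (norm1 (x - y)) (norm1 (x - xi n)) (norm1 (y - xi n)) h => p1 p2 p3; clear; lia.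
have re : `|prop_re chi E s x y| <= 3 ^+ d * t ^+ norm1 (x - y).
  by apply: bound => n; rewrite ler_norml cos_geN1 cos_le1.
have im : `|prop_im chi E s x y| <= 3 ^+ d * t ^+ norm1 (x - y).
  by apply: bound => n; rewrite ler_norml sin_geN1 sin_le1.
rewrite -mulrA mulr_natl mulr2n; apply: le_trans (lerD re im).
rewrite -[leRHS]ger0_norm ?addr_ge0 // -sqrtr_sqr; apply: ler_wsqrtr.
rewrite sqrrD !real_normK ?num_real // lerD2r lerDl mulrn_wge0 // mulr_ge0 //.
Qed.

End LocalizedFamily.

(** * The infinite-volume limit *)

(** Compactness makes every bounded sequence converge along the same ultrafilter, so all entries of
    all modes have limits at once, without extracting subsequences. *)
Lemma ultrafilter_bounded_cvg (R : realType) (T : Type) (U : set_system T) (f : T -> R) M :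
  UltraFilter U -> (forall n, `|f n| <= M) -> exists l : R, f @ U --> l.
Proof.
move=> UU fM; have := @segment_compact R (- M) M.
have fU : (f @ U) `[- M, M]%classic.
  have h n : `[- M, M]%classic (f n) by rewrite set_itvE /= -ler_norml; exact: fM.
  by apply: (@filterE _ U) => n; exact: h.
move=> /(_ (f @ U) _ fU) [l [_ hl]]; exists l => B Bl.
case: (in_ultra_setVsetC (f @^-1` B) UU) => // h.
have [y [ny By]] := hl (~` B) B h Bl; by case: ny.
Qed.

Lemma ultrafilter_nat : exists2 U : set_system nat, UltraFilter U & \oo `<=` U.
Proof. by have [U [UU sU]] := @ultraFilterLemma nat \oo _; exists U. Qed.

Section Limit.
Variables (R : realType) (d : nat) (tau gamma L : R) (w : 'I_d -> R) (v : R -> R) (theta : R).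
Hypothesis w_DC : DC tau gamma w.
Hypothesis v_UBLM : UBLM L v.
Hypothesis tau_gt0 : 0 < tau.
Hypothesis gamma_gt0 : 0 < gamma.
Hypothesis L_gt0 : 0 < L.
Hypothesis nonres : ~ in_resonant_orbit w theta.

Lemma scale_valid_eventually r : (0 < r)%N -> \forall n \near \oo, scale_valid tau gamma n r.
Proof.
move=> r0; have r1 : 0 < r%:R :> R by rewrite ltr0n.
have c0 : 0 < gamma / 2 * powR r%:R (- tau) by rewrite mulr_gt0 ?divr_gt0 // powR_gt0.
exists (maxn r (Num.bound (r%:R / (gamma / 2 * powR r%:R (- tau))))) => // n /=.
rewrite geq_max => /andP[h1 h2]; apply/andP; split; last exact: leqW.
rewrite ler_pdivrMr ?ltr0n // mulrC -ler_pdivrMr // ltW //.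
apply: (@lt_le_trans _ _ (Num.bound (r%:R / (gamma / 2 * powR r%:R (- tau))))%:R).
  by apply: archi_boundP; rewrite divr_ge0 // ltW.
by rewrite ler_nat; exact: leqW.
Qed.

Lemma approx_phase_cvg x : (fun n => approx_phase w n theta x) @ \oo --> theta + dotw x w.
Proof.
apply/cvgrPdist_le => /= e e0.
pose K : R := 2 + (norm1 x)%:R.
have K0 : 0 <= K / e by rewrite divr_ge0 ?addr_ge0 // ltW.
exists (Num.bound (K / e)) => // n /= hn; set q : R := n.+1%:R.
have q0 : 0 < q by rewrite ltr0n.
have hK : K / q <= e.
  rewrite ler_pdivrMr // mulrC -ler_pdivrMr // ltW //.
  by apply: lt_le_trans (archi_boundP K0) _; rewrite ler_nat; exact: leqW.
apply: le_trans hK; rewrite /approx_phase -/q.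
have -> : theta + dotw x w - ((Num.floor (q * theta) + dotp w n x)%:~R + 1 / 2) / q =
    (q * theta - (Num.floor (q * theta))%:~R - 1 / 2) / q - ((dotp w n x)%:~R / q - dotw x w).
  by rewrite rmorphD /=; field; rewrite gt_eqF.
apply: le_trans (ler_normB _ _) _; rewrite /K [leRHS]mulrDl; apply: lerD; last exact: dotp_approx.
rewrite normrM normfV [`|q|]ger0_norm ?(ltW q0) // ler_pM2r ?invr_gt0 //.
have := floor_le (q * theta); have := floorD1_gt (q * theta); rewrite rmorphD /= ler_norml => h1 h2.
apply/andP; split; lra.
Qed.

(** Nonresonance keeps [theta + dotw x w] off the integers, so its fractional part is a continuity
    point of [v]; the integer part is removed by periodicity. *)
Lemma potential_cvg x : (fun n => v (approx_phase w n theta x)) @ \oo --> v (theta + dotw x w).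
Proof.
set t0 := theta + dotw x w; pose k := Num.floor t0; pose s := t0 - k%:~R.
have s0 : 0 < s.
  rewrite /s subr_gt0 lt_neqAle floor_le andbT; apply/eqP => e; apply: nonres.
  exists k, (- x); rewrite e /t0 /dotw -[LHS]addr0 -addrA; congr (_ + _).
  by rewrite -big_split big1 //= => i _; rewrite mxE rmorphN mulNr subrr.
have s1 : s < 1 by rewrite /s ltrBlDr addrC; have := floorD1_gt t0; rewrite rmorphD.
have [_ [cont _]] := v_UBLM.
have cs : {for s, continuous v}.
  move: cont; rewrite continuous_open_subspace; last exact: interval_open.
  by apply; rewrite inE /= in_itv /= s0 s1.
have per u : 0 < u -> u < 1 -> v (u + k%:~R) = v u.
  by move=> u0 u1; apply: UBLM_periodic v_UBLM _; exact: open_unit_notin.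
have cv : (fun n => approx_phase w n theta x - k%:~R) @ \oo --> s.
  by apply: cvgB; [exact: approx_phase_cvg|exact: cvg_cst].
have -> : t0 = s + k%:~R by rewrite /s subrK.
rewrite per //.
have near01 : \forall n \near \oo, 0 < approx_phase w n theta x - k%:~R < 1.
  near=> n; apply/andP; split; near: n; [exact: (cvgr_gt _ cv)|exact: (cvgr_lt _ cv)].
have cv2 : (fun n => v (approx_phase w n theta x - k%:~R)) @ \oo --> v s.
  exact: (cvg_comp _ _ cv cs).
apply: cvg_trans cv2; apply: near_eq_cvg; near=> n.
have /andP[h0 h1] : 0 < approx_phase w n theta x - k%:~R < 1 by near: n.
by rewrite -[in RHS](subrK (k%:~R : R) (approx_phase w n theta x)) per.
Unshelve. all: by end_near. Qed.

Variables (m : nat) (sig rho eps : R).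
Hypothesis m_large : tau + 1 <= m%:R.
Hypothesis sig_gt0 : 0 < sig.
Hypothesis sig_small : sig <= 1 / 80.
Hypothesis sig_base : 8 * sig * (scale_base m)%:R ^+ m <= L * Num.min 1 (gamma / 2).
Hypothesis rho_ge1 : 1 <= rho.
Hypothesis eps_ge0 : 0 <= eps.
Hypothesis eps_small : eps * ((2 * d)%:R * expR rho) <= sig ^+ 2.

Lemma localized_modes : exists (phi : Zd d -> Zd d -> R) (lam : Zd d -> R),
  [/\ forall x y, Hop eps v w theta (phi x) y = lam x * phi x y,
      forall x, phi x x = 1,
      forall x y, x != y -> `|phi x y| <= 1 / 4 * expR (- (rho / 2)) ^+ norm1 (y - x)
    & injective lam].
Proof.
have ex n : exists pl : (Zd d -> Zd d -> R) * (Zd d -> R),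
  [/\ forall x y, eps * Lap (pl.1 x) y + v (approx_phase w n theta y) * pl.1 x y = pl.2 x * pl.1 x y,
      forall x, pl.1 x x = 1,
      forall x y, `|pl.1 x y| <= 1,
      forall x y, x != y -> scale_valid tau gamma n (2 * norm1 (y - x)) ->
        `|pl.1 x y| <= 1 / 4 * expR (- (rho / 2)) ^+ norm1 (y - x)
    & forall x y, x != y -> scale_valid tau gamma n (2 * norm1 (y - x)) ->
        L * (gamma / 2 * powR (norm1 (y - x))%:R (- tau)) <= `|pl.2 y - pl.2 x|].
  have [phi [lam h]] := lattice_approximant w_DC v_UBLM tau_gt0 gamma_gt0 L_gt0 n theta m_large
    sig_gt0 sig_small sig_base rho_ge1 eps_ge0 eps_small.
  by exists (phi, lam).
have [pl hpl] := choice ex.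
have [U UU ooU] := ultrafilter_nat.
have pot_cvg y : (fun n => v (approx_phase w n theta y)) @ U --> v (theta + dotw y w).
  by move=> A /(@potential_cvg y); exact: ooU.
have ev (P : nat -> Prop) : (\forall n \near \oo, P n) -> \forall n \near U, P n.
  exact: ooU.
have phi_ex x : exists g : Zd d -> R, forall y, (fun n => (pl n).1 x y) @ U --> g y.
  have lim y : exists l : R, (fun n => (pl n).1 x y) @ U --> l.
    apply: (ultrafilter_bounded_cvg (M := 1)) => n.
    by have [_ _ + _ _] := hpl n; apply.
  by have [g hg] := choice lim; exists g.
have [phi hphi] := choice phi_ex.
have Lap_cvg x y : (fun n => Lap ((pl n).1 x) y) @ U --> Lap (phi x) y.
  rewrite /Lap; apply: (cvg_finsum (r := index_enum 'I_d)
    (f := fun i n => (pl n).1 x (y + unitv i) + (pl n).1 x (y - unitv i))) => i.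
  by apply: cvgD; exact: hphi.
have op_cvg x y : (fun n => eps * Lap ((pl n).1 x) y + v (approx_phase w n theta y) * (pl n).1 x y) @ U -->
    Hop eps v w theta (phi x) y.
  apply: cvgD; first by apply: cvgMl_tmp; exact: Lap_cvg.
  by apply: cvgM; [exact: pot_cvg|exact: hphi].
(* The approximate eigenvalues come with no a priori bound. The equation at [y = x], where the mode
   is 1, expresses them through quantities already known to converge. *)
pose lam x := Hop eps v w theta (phi x) x.
have lam_cvg x : (fun n => (pl n).2 x) @ U --> lam x.
  rewrite (_ : (fun n => (pl n).2 x) =
    (fun n => eps * Lap ((pl n).1 x) x + v (approx_phase w n theta x) * (pl n).1 x x)) //.
  by apply/funext => n; have [-> -> _ _ _] := hpl n; rewrite mulr1.
have phi_id x : phi x x = 1.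
  rewrite -(cvg_lim (@Rhausdorff R) (hphi x x)); apply: cvg_lim => //.
  rewrite (_ : (fun n => (pl n).1 x x) = cst 1); first exact: cvg_cst.
  by apply/funext => n; have [_ -> _ _ _] := hpl n.
have valid (x y : Zd d) : x != y -> \forall n \near U, scale_valid tau gamma n (2 * norm1 (y - x)).
  move=> xy; apply/ev/scale_valid_eventually; rewrite muln_gt0 /= lt0n norm1_eq0 subr_eq0.
  by rewrite eq_sym.
exists phi, lam; split=> //.
- move=> x y; have h1 := op_cvg x y.
  have h2 : (fun n => (pl n).2 x * (pl n).1 x y) @ U --> lam x * phi x y by apply: cvgM; [exact: lam_cvg|exact: hphi].
  have e : (fun n => (pl n).2 x * (pl n).1 x y) =
      (fun n => eps * Lap ((pl n).1 x) y + v (approx_phase w n theta y) * (pl n).1 x y).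
    by apply/funext => n; have [-> _ _ _ _] := hpl n.
  rewrite e in h2; have e1 := cvg_lim (@Rhausdorff R) h1; have e2 := cvg_lim (@Rhausdorff R) h2.
  by rewrite -e1 -[RHS]e2.
- move=> x y xy.
  have h : (fun n => `|(pl n).1 x y|) @ U --> `|phi x y| by apply: cvg_norm; exact: hphi.
  rewrite -(cvg_lim (@Rhausdorff R) h); apply: limr_le; first by apply/cvg_ex; eexists; exact: h.
  by apply: filterS _ (valid x y xy) => n; have [_ _ _ + _] := hpl n; apply.
- move=> x y e; apply/eqP; apply: contraT => xy.
  have h : (fun n => `|(pl n).2 y - (pl n).2 x|) @ U --> `|lam y - lam x|.
    by apply: cvg_norm; apply: cvgB; exact: lam_cvg.
  (* The lower bound on eigenvalue differences is independent of [n] and passes to the limit, whence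
     simplicity of the spectrum. *)
  have : L * (gamma / 2 * powR (norm1 (y - x))%:R (- tau)) <= `|lam y - lam x|.
    rewrite -(cvg_lim (@Rhausdorff R) h); apply: limr_ge; first by apply/cvg_ex; eexists; exact: h.
    by apply: filterS _ (valid x y xy) => n; have [_ _ _ _ +] := hpl n; apply.
  rewrite e subrr normr0 leNgt mulr_gt0 // mulr_gt0 ?divr_gt0 // powR_gt0 // ltr0n lt0n norm1_eq0 subr_eq0.
  by rewrite eq_sym.
Qed.

End Limit.

Theorem theorem1p2 (R : realType) (d : nat) (tau gamma L : R) :
  (1 <= d)%N -> d%:R < tau -> 0 < gamma -> 0 < L ->
  exists eps0 : R, 0 < eps0 /\
    forall (w : 'I_d -> R) (v : R -> R), DC tau gamma w -> UBLM L v ->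
    forall eps : R, 0 <= eps -> eps <= eps0 ->
    forall theta : R, ~ in_resonant_orbit w theta ->
      anderson_loc (Hop eps v w theta) /\
      (forall (psi : nat -> Zd d -> R) (E : nat -> R),
         eigenbasis (Hop eps v w theta) psi E ->
         exists C : R, forall (x y : Zd d) (t : R),
           prop_abs psi E t x y <= C * decay_bound eps (norm1 (x - y))).
Proof.
move=> d1 dtau gamma0 L0.
have tau0 : 0 < tau by apply: le_lt_trans dtau.
pose m := Num.bound (tau + 1).
have m_large : tau + 1 <= m%:R by apply/ltW/archi_boundP; rewrite addr_ge0 // ltW.
pose c := L * Num.min 1 (gamma / 2).
have c0 : 0 < c by rewrite mulr_gt0 // lt_min ltr01 divr_gt0.
have b0 : 0 < (scale_base m)%:R ^+ m :> R.
  by rewrite exprn_gt0 // ltr0n /scale_base muln_gt0 expn_gt0.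
pose sig := Num.min (1 / 80) (c / (8 * (scale_base m)%:R ^+ m)).
have sig0 : 0 < sig by rewrite lt_min divr_gt0 //= divr_gt0 // mulr_gt0.
have sig_small : sig <= 1 / 80 by rewrite ge_min lexx.
have sig_base : 8 * sig * (scale_base m)%:R ^+ m <= c.
  by rewrite mulrAC mulrC -ler_pdivlMr ?mulr_gt0 // ge_min lexx orbT.
(* Through [1 + x <= expR x], the first term makes [expR (- (rho / 4))] at most [1 / 2] and small
   against [3 ^- d]; the second makes [2 d] hops of weight [expR (- rho)] at most [sig ^+ 2]. *)
pose rho0 := 8 * 3 ^+ d + (2 * d)%:R / sig ^+ 2.
have three : 1 <= 3 ^+ d :> R by rewrite exprn_ege1 // ler1n.
have rest0 : 0 <= (2 * d)%:R / sig ^+ 2 by rewrite divr_ge0 // sqr_ge0.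
(* The weight [rho] is half of [|ln eps|], so that [eps * expR rho = expR (- rho)]. *)
exists (expR (- (2 * rho0))); split; first exact: expR_gt0.
move=> w v wDC vU eps eps_ge0 eps_le theta nonres.
have conclude (t : R) (phi : Zd d -> Zd d -> R) (lam : Zd d -> R) :
    0 <= t -> t <= 1 / 2 -> t * 3 ^+ d <= 1 ->
    (forall x y, Hop eps v w theta (phi x) y = lam x * phi x y) ->
    (forall x, phi x x = 1) ->
    (forall x y, x != y -> `|phi x y| <= 1 / 4 * (t ^+ 2) ^+ norm1 (y - x)) -> injective lam ->
    (forall n, t ^+ n <= decay_bound eps n) ->
    anderson_loc (Hop eps v w theta) /\
      (forall (psi : nat -> Zd d -> R) (E : nat -> R),
         eigenbasis (Hop eps v w theta) psi E ->
         exists C : R, forall (x y : Zd d) (t : R),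
           prop_abs psi E t x y <= C * decay_bound eps (norm1 (x - y))).
  move=> t0 t1 t2 h1 h2 h3 h4 h5; split; first exact: localized_anderson d1 t0 t1 t2 h1 h2 h3 h4.
  move=> psi E /(localized_propagation d1 t0 t1 t2 h1 h2 h3 h4) [C hC]; exists `|C| => x y s.
  apply: le_trans (hC x y s) _; apply: (@le_trans _ _ (`|C| * t ^+ norm1 (x - y))).
    by apply: ler_wpM2r; [exact: exprn_ge0|exact: ler_norm].
  exact: ler_wpM2l.
have small_weight rho : rho0 <= rho -> [/\ expR (- (rho / 4)) <= 1 / 2, expR (- (rho / 4)) * 3 ^+ d <= 1,
    1 <= rho & (2 * d)%:R * expR (- rho) <= sig ^+ 2].
  move=> hr; have e4 : 2 * 3 ^+ d <= expR (rho / 4).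
    apply: le_trans (expR_ge1Dx _); move: hr; rewrite /rho0; lra.
  have er : (2 * d)%:R / sig ^+ 2 <= expR rho.
    apply: le_trans (expR_ge1Dx _); move: hr; rewrite /rho0; lra.
  rewrite !expRN; split.
  - by rewrite mul1r lef_pV2 ?posrE ?expR_gt0 //; lra.
  - by rewrite mulrC ler_pdivrMr ?expR_gt0 // mul1r; lra.
  - by move: hr; rewrite /rho0; lra.
  - by rewrite ler_pdivrMr ?expR_gt0 // mulrC -ler_pdivrMr // exprn_gt0.
have sqr_weight rho : expR (- (rho / 4)) ^+ 2 = expR (- (rho / 2)) :> R.
  by rewrite -expRM_natr; congr expR; field.
(* At [eps = 0] the bound requires exact point modes, i.e. decay with [t = 0]. The operator is then
   multiplication by the distinct values [lam], so [phi x] vanishes off [x]. *)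
have [e0|epos] := eqVneq eps 0.
  have [t1 t2 r1 _] := small_weight rho0 (lexx _).
  have es : eps * ((2 * d)%:R * expR rho0) <= sig ^+ 2 by rewrite e0 mul0r sqr_ge0.
  have [phi [lam [h1 h2 h3 h4]]] := localized_modes wDC vU tau0 gamma0 L0 nonres
    m_large sig0 sig_small sig_base r1 eps_ge0 es.
  apply: (conclude 0 phi lam) => //.
  - move=> x y xy.
    have lamE z : lam z = v (theta + dotw z w).
      by have := h1 z z; rewrite /Hop h2 e0 mul0r add0r !mulr1.
    have := h1 x y; rewrite /Hop e0 mul0r add0r -lamE => /eqP.
    rewrite -subr_eq0 -mulrBl mulf_eq0 subr_eq0 => /orP[/eqP /h4 yx|/eqP ->].
      by rewrite yx eqxx in xy.
    by rewrite normr0 mulr_ge0 // exprn_ge0.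
  - by move=> n; rewrite /decay_bound e0 eqxx expr0n; case: n.
have eps_gt0 : 0 < eps by rewrite lt_neqAle eq_sym epos.
pose rho := - ln eps / 2.
have ln_le : ln eps <= - (2 * rho0) by rewrite -(expRK (- (2 * rho0))) ler_ln ?posrE ?expR_gt0.
have rho_ge : rho0 <= rho by rewrite /rho; lra.
have [t1 t2 r1 hs] := small_weight rho rho_ge.
have epsE : eps = expR (- (2 * rho)).
  by rewrite -{1}(@lnK R eps) ?posrE //; congr expR; rewrite /rho; field.
have es : eps * ((2 * d)%:R * expR rho) <= sig ^+ 2.
  apply: le_trans hs; rewrite mulrCA epsE -expRD le_eqVlt; apply/orP; left; apply/eqP.
  by congr (_ * expR _); ring.
have [phi [lam [h1 h2 h3 h4]]] := localized_modes wDC vU tau0 gamma0 L0 nonres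
  m_large sig0 sig_small sig_base r1 eps_ge0 es.
apply: (conclude (expR (- (rho / 4))) phi lam) => //.
  by move=> x y xy; rewrite sqr_weight; exact: h3.
(* Here [expR (- (rho / 4))] is [eps] to the power [1 / 8], well below the required power
   [1 / 800]. *)
move=> n; rewrite /decay_bound (negbTE epos) -expRM_natr ler_expR.
apply: ler_wpM2r => //.
have lneg : ln eps <= 0 by apply: le_trans ln_le _; move: rest0; rewrite /rho0; lra.
rewrite ler0_norm // /rho; lra.
Qed.
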